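(* Consider the three-layer delayed hierarchical system described in the context, with interlayer delays $\tau_2,\tau_3\ge0$. Then, for every initial value $x^{(1)}_0$, all physical-layer states converge to the consensus \[ \lim_{t\to\infty}x^{(1)}(t)=\frac{\mathbf{1}\mathbf{1}^TK}{\mathbf{1}^TK\mathbf{1}}\,x^{(1)}_0,\qquad K=\mathrm{diag}(a_1,\dots,a_{N^{(1)}}), \] if and only if both \[ \tau_2<\frac{\pi}{4\lambda^{(2)}_{\max}}\quad\text{and}\quad \tau_2+\tau_3<\frac{\pi}{4\lambda^{(3)}_{\max}}, \] where $\lambda^{(2)}_{\max}$ and $\lambda^{(3)}_{\max}$ are the maximum eigenvalues of $L^{(2)}$ and $L^{(3)}$, respectively.
   Context: Three-layer hierarchical structure ($M=3$). Fix positive integers $N^{(1)},N^{(2)},N^{(3)}$ and set $N^{(4)}:=1$. For each $l\in\{1,2,3\}$ the $N^{(l)}$ nodes of layer $l$ are partitioned into $N^{(l+1)}$ groups $G^{(l)}_1,\dots,G^{(l)}_{N^{(l+1)}}$ of sizes $k^{(l)}_p\ge1$, numbered consecutively: group $G^{(l)}_p$ consists of nodes $\sum_{m<p}k^{(l)}_m+1,\dots,\sum_{m\le p}k^{(l)}_m$ of layer $l$; group $G^{(l)}_p$ ($l\le2$) is subordinate to node $p$ of layer $l+1$. Each group carries a connected undirected graph with binary adjacency matrix; $L^{(l)}_p$ is its Laplacian, $L^{(l)}_D=\mathrm{diag}(L^{(l)}_1,\dots,L^{(l)}_{N^{(l+1)}})$. Weights: positive constants $a_1,\dots,a_{N^{(1)}}$;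 $a^{(1)}_i=a_i$, $a^{(l+1)}_p=\sum_{i\in G^{(l)}_p}a^{(l)}_i$; $K^{(l)}=\mathrm{diag}(a^{(l)}_1,\dots,a^{(l)}_{N^{(l)}})^{-1}$. For $l=1,2$: $B^{(l)}=\mathrm{diag}(\mathbf{1}_{k^{(l)}_1},\dots,\mathbf{1}_{k^{(l)}_{N^{(l+1)}}})\in\mathbb{R}^{N^{(l)}\times N^{(l+1)}}$ ($\mathbf 1_k$ all-ones column vector), $C^{(l)}=\mathrm{diag}(C^{(l)}_1,\dots,C^{(l)}_{N^{(l+1)}})\in\mathbb{R}^{N^{(l+1)}\times N^{(l)}}$ with each row vector $C^{(l)}_p$ having nonnegative entries summing to $1$. $L^{(1)}=K^{(1)}L^{(1)}_D$, $L^{(2)}=B^{(1)}K^{(2)}L^{(2)}_DC^{(1)}$, $L^{(3)}=B^{(1)}B^{(2)}K^{(3)}L^{(3)}_DC^{(2)}C^{(1)}$ (these have real nonnegative eigenvalues). Delayed system ($\tau_2$ is the communication delay between layers 1 and 2, $\tau_3$ between layers 2 and 3): $\dot x^{(1)}(t)=-K^{(1)}L^{(1)}_Dx^{(1)}(t)+y^{(1)}(t)$, $x^{(2)}(t)=C^{(1)}x^{(1)}(t-\tau_2)$, $y^{(1)}(t)=B^{(1)}\big[-K^{(2)}L^{(2)}_Dx^{(2)}(t-\tau_2)+y^{(2)}(t-\tau_2)\big]$, $x^{(3)}(t)=C^{(2)}x^{(2)}(t-\tau_3)$, $y^{(2)}(t)=B^{(2)}\big[-K^{(3)}L^{(3)}_Dx^{(3)}(t-\tau_3)\big]$,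 with $x^{(1)}(0)=x^{(1)}_0$ and all signals taken to be zero at negative time arguments. *)

(* Defs.v *)
From HB Require Import structures.
From mathcomp Require Import all_boot all_order all_algebra.
From mathcomp Require Import all_classical all_reals all_analysis.
Set Implicit Arguments. Unset Strict Implicit. Unset Printing Implicit Defensive.
Import Order.TTheory GRing.Theory Num.Theory.
Import numFieldNormedType.Exports.
Local Open Scope classical_set_scope.
Local Open Scope ring_scope.

(* Consecutive grouping: node i of layer l lies in group g i (group g i is
   subordinate to node g i of layer l+1). Groups are consecutive blocks of
   sizes >= 1 iff g is nondecreasing and surjective. *)
Definition consecutive_grouping (n m : nat) (g : 'I_n -> 'I_m) : Prop :=
  (forall i j : 'I_n, (i <= j)%N -> (g i <= g j)%N) /\
  (forall p : 'I_m, exists i : 'I_n, g i = p).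

Definition undirected_graph (n : nat) (adj : rel 'I_n) : Prop :=
  (forall i j, adj i j = adj j i) /\ (forall i, ~~ adj i i).

Definition groupwise_connected_graph (n m : nat) (g : 'I_n -> 'I_m)
  (adj : rel 'I_n) : Prop :=
  undirected_graph adj /\
  (forall i j, adj i j -> g i = g j) /\
  (forall i j, g i = g j -> connect adj i j).

(* Laplacian D - A of the binary adjacency relation; for groupwise graphs
   this is the block-diagonal matrix L_D = diag(L_1, ..., L_m). *)
Definition laplacian (R : pzRingType) (n : nat) (adj : rel 'I_n) : 'M[R]_n :=
  \matrix_(i, j) (if i == j then (#|[pred k | adj i k]|)%:R
                  else - (adj i j)%:R).

(* B = diag(1_{k_1}, ..., 1_{k_m}) *)
Definition group_B (R : pzRingType) (n m : nat) (g : 'I_n -> 'I_m) : 'M[R]_(n, m) :=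
  \matrix_(i, p) (g i == p)%:R.

(* C = diag(C_1, ..., C_m), each row vector C_p nonnegative summing to 1 *)
Definition group_C (R : numDomainType) (n m : nat) (g : 'I_n -> 'I_m)
  (C : 'M[R]_(m, n)) : Prop :=
  (forall p i, g i != p -> C p i = 0) /\
  (forall p i, 0 <= C p i) /\
  (forall p, \sum_i C p i = 1).

Definition agg_weights (R : pzRingType) (n m : nat) (g : 'I_n -> 'I_m)
  (a : 'I_n -> R) : 'I_m -> R :=
  fun p => \sum_(i | g i == p) a i.

Definition Kmat (R : fieldType) (n : nat) (a : 'I_n -> R) : 'M[R]_n :=
  diag_mx (\row_i (a i)^-1).

(* lam is the maximum eigenvalue of A (eigenvalues of the matrices
   considered are real, per the context) *)
Definition is_max_eigenvalue (R : realFieldType) (n : nat) (A : 'M[R]_n)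
  (lam : R) : Prop :=
  eigenvalue A lam /\ (forall mu, eigenvalue A mu -> mu <= lam).

Section System.
Variables (R : realType) (N1 N2 N3 : nat).
Variables (g1 : 'I_N1 -> 'I_N2) (g2 : 'I_N2 -> 'I_N3).
Variables (adj1 : rel 'I_N1) (adj2 : rel 'I_N2) (adj3 : rel 'I_N3).
Variables (a : 'I_N1 -> R).
Variables (C1 : 'M[R]_(N2, N1)) (C2 : 'M[R]_(N3, N2)).
Variables (tau2 tau3 : R).

Definition a2 : 'I_N2 -> R := agg_weights g1 a.
Definition a3 : 'I_N3 -> R := agg_weights g2 a2.
Definition K1 : 'M[R]_N1 := Kmat a.
Definition K2 : 'M[R]_N2 := Kmat a2.
Definition K3 : 'M[R]_N3 := Kmat a3.
Definition LD1 : 'M[R]_N1 := laplacian R adj1.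
Definition LD2 : 'M[R]_N2 := laplacian R adj2.
Definition LD3 : 'M[R]_N3 := laplacian R adj3.
Definition B1 : 'M[R]_(N1, N2) := group_B R g1.
Definition B2 : 'M[R]_(N2, N3) := group_B R g2.

Definition Lmat1 : 'M[R]_N1 := K1 *m LD1.
Definition Lmat2 : 'M[R]_N1 := B1 *m K2 *m LD2 *m C1.
Definition Lmat3 : 'M[R]_N1 := B1 *m B2 *m K3 *m LD3 *m C2 *m C1.

(* The delayed hierarchical system with initial value x0, all signals zero
   at negative times. x1 is continuous on [0, +oo) and satisfies the ODE
   at every t > 0 except possibly finitely many points (the right-hand
   side has jumps at the times where delayed signals switch on). *)
Definition hier_solution (x0 : 'cV[R]_N1)
  (x1 : R -> 'cV[R]_N1) (x2 : R -> 'cV[R]_N2) (x3 : R -> 'cV[R]_N3)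
  (y1 : R -> 'cV[R]_N1) (y2 : R -> 'cV[R]_N2) : Prop :=
  (forall t, t < 0 ->
        x1 t = 0 /\ x2 t = 0 /\ x3 t = 0 /\ y1 t = 0 /\ y2 t = 0) /\
  x1 0 = x0 /\
  {within `[0, +oo[, continuous x1} /\
  (exists s : seq R, forall t, 0 < t -> t \notin s ->
     is_derive t 1 x1 (- (K1 *m LD1 *m x1 t) + y1 t)) /\
  (forall t, 0 <= t -> x2 t = C1 *m x1 (t - tau2)) /\
  (forall t, 0 <= t ->
     y1 t = B1 *m (- (K2 *m LD2 *m x2 (t - tau2)) + y2 (t - tau2))) /\
  (forall t, 0 <= t -> x3 t = C2 *m x2 (t - tau3)) /\
  (forall t, 0 <= t -> y2 t = B2 *m (- (K3 *m LD3 *m x3 (t - tau3)))).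

Definition consensus (x0 : 'cV[R]_N1) : 'cV[R]_N1 :=
  let one : 'cV[R]_N1 := const_mx 1 in
  let K : 'M[R]_N1 := diag_mx (\row_i a i) in
  ((one^T *m K *m one) 0 0)^-1 *: (one *m one^T *m K *m x0).

End System.

(* Main.v *)
(** The closed loop is [x' = - L1 x(t) - L2 x(t - tau) - L3 x(t - sigma)] with
    [tau = 2 tau2] and [sigma = 2 (tau2 + tau3)]. Subtracting group averages layer by
    layer triangularises it: each layer obeys [z' = - K L_D z(t - r) + f], where [f]
    comes from the layers below, and the total weighted average is conserved.
    [K L_D] is diagonalisable with nonnegative eigenvalues, so everything reduces to
    the scalar equation [y' = - mu y(t - r) + f].

    Stability ([mu r < pi / 2], [f] square integrable): the functional
    [V = int_(t-r)^t (y'^2 - mu^2 y^2) + 2 mu y(t) y(t - r)] satisfies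
    [V' = f^2 - g^2] with [g = mu y - y'(t - r)], and [V >= 0] by the Dirichlet
    principle on an interval of length less than [pi / (2 mu)]; hence [g] is square
    integrable. Then [(y, y(t - r))] is a harmonic oscillator driven by [f] and [g],
    and following its rotation over one delay gives [y' = - kappa y + h] with
    [kappa > 0] and [h] square integrable.

    Instability ([mu r >= pi / 2]): for a root [s] of [s + mu exp (- s r)] with
    nonnegative real part, [exp (- s t) y(t) + s int_(t-r)^t exp (- s v) y(v) dv] is a
    nonzero constant along the solution with [y(0) <> 0] and zero history, so [y]
    does not tend to [0]. *)
Require Import Defs.
From HB Require Import structures.
From mathcomp Require Import all_boot all_order all_algebra.
From mathcomp Require Import all_classical all_reals all_analysis.
From mathcomp Require Import ring lra sesquilinear spectral.
From mathcomp.real_closed Require complex.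
Import Order.TTheory GRing.Theory Num.Theory.
Import numFieldNormedType.Exports.
Local Open Scope classical_set_scope.
Local Open Scope ring_scope.
Set Implicit Arguments.
Unset Strict Implicit.
Unset Printing Implicit Defensive.

(** * Derivatives of real functions *)

Section RealDerivatives.
Variable R : realType.
Implicit Types (f g F y : R -> R) (t a b c d : R).

Lemma derD f g t a b : is_derive t 1 f a -> is_derive t 1 g b ->
  is_derive t 1 (fun x => f x + g x) (a + b).
Proof. by move=> fa gb; exact: is_deriveD. Qed.

Lemma derN f t a : is_derive t 1 f a -> is_derive t 1 (fun x => - f x) (- a).
Proof. by move=> fa; exact: is_deriveN. Qed.

Lemma derM f g t a b : is_derive t 1 f a -> is_derive t 1 g b ->
  is_derive t 1 (fun x => f x * g x) (f t * b + g t * a).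
Proof. by move=> fa gb; exact: is_deriveM. Qed.

Lemma der_sqr f t a : is_derive t 1 f a ->
  is_derive t 1 (fun x => f x ^+ 2) (2 * f t * a).
Proof.
move=> fa; apply: is_derive_eq (derM fa fa) _.
by rewrite mulrC -mulrA mulr_natl mulr2n mulrC.
Qed.

Lemma der_cst t c : is_derive t 1 (fun=> c) (0 : R).
Proof. exact: is_derive_cst. Qed.

Lemma der_comp f g t a b : is_derive (g t) 1 f a -> is_derive t 1 g b ->
  is_derive t 1 (fun x => f (g x)) (a * b).
Proof. by move=> fa gb; exact: is_derive1_comp. Qed.

Lemma der_id t : is_derive t 1 (fun x : R => x) 1.
Proof. exact: is_derive_id. Qed.

Lemma der_shift f t c a : is_derive (t - c) 1 f a ->
  is_derive t 1 (fun x => f (x - c)) a.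
Proof.
move=> fa; apply: is_derive_eq (der_comp (g := fun x => x - c) fa
  (derD (der_id _) (derN (der_cst _ _)))) _.
by rewrite oppr0 addr0 mulr1.
Qed.

Lemma der_cos c t : is_derive t 1 (fun x => cos (c * x)) (- (c * sin (c * t))).
Proof.
apply: is_derive_eq (der_comp (g := fun x => c * x) (is_derive_cos _)
  (derM (der_cst _ _) (der_id _))) _.
by rewrite mulr1 mulr0 addr0 mulNr mulrC.
Qed.

Lemma der_sin c t : is_derive t 1 (fun x => sin (c * x)) (c * cos (c * t)).
Proof.
apply: is_derive_eq (der_comp (g := fun x => c * x) (is_derive_sin _)
  (derM (der_cst _ _) (der_id _))) _.
by rewrite mulr1 mulr0 addr0 mulrC.
Qed.

Lemma der_tan c t : cos (c * t) != 0 ->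
  is_derive t 1 (fun x => tan (c * x)) (c * (1 + tan (c * t) ^+ 2)).
Proof.
move=> ct.
apply: is_derive_eq (der_comp (g := fun x => c * x) (is_derive_tan ct)
  (derM (der_cst _ _) (der_id _))) _.
by rewrite mulr1 mulr0 addr0 mulrC -cos2_tan2 // exprVn.
Qed.

Lemma der_eq f t a b : is_derive t 1 f a -> a = b -> is_derive t 1 f b.
Proof. by move=> + <-. Qed.

Lemma der_near f g t a : (\forall x \near t, f x = g x) ->
  is_derive t 1 f a -> is_derive t 1 g a.
Proof. by move=> fg; exact: near_eq_is_derive. Qed.

Lemma der_continuous f t a : is_derive t 1 f a -> {for t, continuous f}.
Proof.
by move=> fa; apply/differentiable_continuous/derivable1_diffP; exact: ex_derive.
Qed.

Lemma derive_ge0_le F (dF : R -> R) a b : a <= b ->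
  (forall t, a <= t <= b -> is_derive t 1 F (dF t)) ->
  (forall t, a <= t <= b -> 0 <= dF t) -> F a <= F b.
Proof.
move=> ab FdF dF0.
have [||c cab] := @MVT_segment _ F dF a b ab.
- move=> x /[!in_itv]/= /andP[ax xb]; apply: FdF.
  by rewrite !ltW.
- by apply: derivable_within_continuous => x /[!in_itv]/= xab; apply: ex_derive; exact: FdF.
by move=> H; rewrite -subr_ge0 H mulr_ge0 ?subr_ge0// dF0.
Qed.

(** The integral is based at [S]; the gap above [T] gives continuity on the closed intervals
    starting at [S], as the fundamental theorem of calculus requires. *)
Lemma antiderivative f T S : T < S ->
  (forall t, T < t -> {for t, continuous f}) ->
  exists F, forall t, S < t -> is_derive t 1 F (f t).
Proof.
move=> TS cf.
exists (fun x => (\int[lebesgue_measure]_(t in [set` `[S, x]]) f t)%R) => t St.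
have tt1 : t < t + 1 by rewrite ltrDl.
have [|H1 H2] := @continuous_FTC1_closed R f S t _ tt1 _ St (cf _ (lt_trans TS St)).
  apply: continuous_compact_integrable; first exact: segment_compact.
  apply: continuous_in_subspaceT => x; rewrite inE/= in_itv/= => /andP[Sx _].
  by apply: cf; exact: lt_le_trans Sx.
by apply: (DeriveDef H1); rewrite -derive1E H2.
Qed.

End RealDerivatives.

(** Differentiation directed by the shape of the function. Derivatives of opaque functions are taken
    from the context; [dereq] leaves the equation between the computed and the expected value. *)
Ltac der := try eassumption; lazymatch goal with
  | |- is_derive _ _ (fun x => x) _ => notypeclasses refine (der_id _)
  | |- is_derive _ _ (fun x => @?f x + @?g x) _ =>
      notypeclasses refine (derD (f := f) (g := g) _ _); der
  | |- is_derive _ _ (fun x => @?f x * @?g x) _ =>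
      notypeclasses refine (derM (f := f) (g := g) _ _); der
  | |- is_derive _ _ (fun x => @?f x ^+ 2) _ =>
      notypeclasses refine (der_sqr (f := f) _); der
  | |- is_derive _ _ (fun x => - @?f x) _ =>
      notypeclasses refine (derN (f := f) _); der
  | |- is_derive _ _ (fun x => cos (?c * x)) _ => notypeclasses refine (der_cos _ _)
  | |- is_derive _ _ (fun x => sin (?c * x)) _ => notypeclasses refine (der_sin _ _)
  | |- is_derive _ _ (fun x => tan (?c * x)) _ => notypeclasses refine (der_tan _)
  | |- is_derive _ _ (fun x => ?f (x - ?c)) _ =>
      notypeclasses refine (der_shift (f := f) _); der
  | |- _ => try notypeclasses refine (der_cst _ _)
  end.

Ltac dereq := notypeclasses refine (der_eq _ _); [der|cbv beta].

(** * Square integrability at infinity *)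

Section SquareIntegrable.
Variable R : realType.
Implicit Types (f g F y : R -> R) (t a b c d mu r : R).

(* [f ^+ 2] is dominated, near infinity, by the derivative of a function bounded above. *)
Definition sqint f := exists (F dF : R -> R) (T M : R), forall t, T < t ->
  [/\ is_derive t 1 F (dF t), f t ^+ 2 <= dF t & F t <= M].

Lemma sqint_near f g T : (forall t, T < t -> f t = g t) -> sqint f -> sqint g.
Proof.
move=> fg [F [dF [S [M H]]]]; exists F, dF, (Num.max T S), M => t.
by rewrite gt_max => /andP[Tt /H[]]; rewrite fg.
Qed.

Lemma sqint0 : sqint (fun=> 0).
Proof.
exists (fun=> 0), (fun=> 0), 0, 0 => t _; split=> //; first exact: der_cst.
by rewrite expr0n.
Qed.

Lemma sqintZ c f : sqint f -> sqint (fun t => c * f t).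
Proof.
move=> [F [dF [S [M H]]]].
exists (fun t => c ^+ 2 * F t), (fun t => c ^+ 2 * dF t), S, (c ^+ 2 * M) => t St.
have [H1 H2 H3] := H _ St; split.
- by dereq; ring.
- by rewrite exprMn ler_wpM2l ?sqr_ge0.
- by rewrite ler_wpM2l ?sqr_ge0.
Qed.

Lemma sqintD f g : sqint f -> sqint g -> sqint (fun t => f t + g t).
Proof.
move=> [F [dF [S [M H]]]] [G [dG [S' [M' H']]]].
exists (fun t => 2 * (F t + G t)), (fun t => 2 * (dF t + dG t)),
  (Num.max S S'), (2 * (M + M')) => t.
rewrite gt_max => /andP[/H[H1 H2 H3] /H'[H'1 H'2 H'3]]; split.
- by dereq; ring.
- by have := sqr_ge0 (f t - g t); lra.
- by rewrite ler_pM2l// lerD.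
Qed.

Lemma sqint_sum (I : Type) (s : seq I) (f : I -> R -> R) :
  (forall i, sqint (f i)) -> sqint (fun t => \sum_(i <- s) f i t).
Proof.
move=> H; elim: s => [|i s IH].
  by apply: (@sqint_near (fun=> 0) _ 0) sqint0 => t _; rewrite big_nil.
by apply: (sqint_near (T := 0)) (sqintD (H i) IH) => t _; rewrite big_cons.
Qed.

Lemma sqint_shift r f : sqint f -> sqint (fun t => f (t - r)).
Proof.
move=> [F [dF [S [M H]]]].
exists (fun t => F (t - r)), (fun t => dF (t - r)), (S + r), M => t.
by rewrite -ltrBrDr => /H[H1 H2 H3]; split => //; der.
Qed.

Lemma ndecr_bounded_cvg F (dF : R -> R) T M :
  (forall t, T < t -> is_derive t 1 F (dF t)) ->
  (forall t, T < t -> 0 <= dF t) -> (forall t, T < t -> F t <= M) ->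
  exists l : R, F t @[t --> +oo] --> l.
Proof.
move=> FdF dF0 FM.
have mono s t : T < s -> s <= t -> F s <= F t.
  move=> Ts st; apply: (@derive_ge0_le _ F dF) => // x /andP[sx _].
    by apply: FdF; apply: lt_le_trans sx.
  by apply: dF0; apply: lt_le_trans sx.
pose E := [set F t | t in [set t | T < t]].
have supE : has_sup E.
  split; first by exists (F (T + 1)), (T + 1) => //=; rewrite ltrDl.
  by exists M => _ [t Tt <-]; exact: FM.
exists (sup E); apply/cvgrPdist_le => e e0.
have [_ [s Ts <-] Hs] := sup_adherent e0 supE.
near=> t.
have st : s <= t by near: t; apply: nbhs_pinfty_ge; rewrite num_real.
have := mono _ _ Ts st => Fst.
have FtE : F t <= sup E.
  by apply: ub_le_sup; [case: supE|exists t => //=; apply: lt_le_trans st].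
rewrite ger0_norm ?subr_ge0//; lra.
Unshelve. all: by end_near. Qed.

(** As [2 y y' <= y ^+ 2 + y' ^+ 2], both [F + G] and [F + G - y ^+ 2] are nondecreasing and bounded
    above, so [y ^+ 2] has a limit. A positive limit would make [F] grow linearly. *)
Lemma sqint_cvg0 y (dy : R -> R) T : (forall t, T < t -> is_derive t 1 y (dy t)) ->
  sqint y -> sqint dy -> y t @[t --> +oo] --> 0.
Proof.
move=> ydy [F [dF [S [M H]]]] [G [dG [S' [M' H']]]].
pose T' := Num.max T (Num.max S S').
have HT t : T' < t -> [/\ T < t, S < t & S' < t].
  by rewrite !gt_max => /and3P[].
have [l1 Fl1] : exists l : R, F t + G t @[t --> +oo] --> l.
  apply: (@ndecr_bounded_cvg _ (fun t => dF t + dG t) T' (M + M')).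
  - by move=> t /HT[_ /H[? _ _] /H'[? _ _]]; der.
  - move=> t /HT[_ /H[_ Ht _] /H'[_ Ht' _]].
    by rewrite addr_ge0// ?(le_trans _ Ht) ?(le_trans _ Ht') ?sqr_ge0.
  - by move=> t /HT[_ /H[_ _ ?] /H'[_ _ ?]]; rewrite lerD.
have [l2 Fl2] : exists l : R, F t + G t - y t ^+ 2 @[t --> +oo] --> l.
  apply: (@ndecr_bounded_cvg _ (fun t => dF t + dG t - 2 * y t * dy t) T' (M + M')).
  - by move=> t /HT[/ydy ? /H[? _ _] /H'[? _ _]]; der.
  - move=> t /HT[_ /H[_ H2 _] /H'[_ H2' _]].
    have := sqr_ge0 (y t - dy t); lra.
  - move=> t /HT[_ /H[_ _ ?] /H'[_ _ ?]]; have := sqr_ge0 (y t); lra.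
have yl : y t ^+ 2 @[t --> +oo] --> l1 - l2.
  apply: cvg_trans (cvgB Fl1 Fl2); apply: near_eq_cvg.
  by near=> t; rewrite /= opprB addrC subrK.
have l0 : 0 <= l1 - l2.
  apply: (cvgr_to_ge yl).
  by near=> t; exact: sqr_ge0.
have {l0} l0 : l1 - l2 = 0.
  apply/eqP; rewrite eq_le l0 andbT leNgt; apply/negP => lp.
  set l := l1 - l2 in yl lp.
  have l2p : l / 2 < l by lra.
  have /= [A [_ HA]] := cvgr_gt l yl _ l2p.
  pose B := Num.max A T' + 1.
  have BP t : B <= t -> [/\ l / 2 < y t ^+ 2, T < t, S < t & S' < t].
    move=> Bt; have : Num.max A T' < t by apply: lt_le_trans Bt; rewrite ltrDl.
    by rewrite gt_max => /andP[At /HT[? ? ?]]; split=> //; exact: HA.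
  have H1 t : B <= t -> F B - l / 2 * B <= F t - l / 2 * t.
    move=> Bt; apply: (@derive_ge0_le _ (fun t => F t - l / 2 * t)
      (fun t => dF t - l / 2)) => // s /andP[Bs _].
      have [_ _ /H[? _ _] _] := BP _ Bs.
      by dereq; ring.
    have [? _ /H[_ ? _] _] := BP _ Bs; lra.
  (* From [B] on, [F] has slope at least [l / 2], so by this time it has risen by more than
     [M - F B]. *)
  pose t := B + (`|M - F B| + 1) / (l / 2).
  have Bt : B <= t by rewrite lerDl divr_ge0 ?addr_ge0//; lra.
  have := H1 _ Bt; have [_ _ /H[_ _ ?] _] := BP _ Bt.
  have : l / 2 * t - l / 2 * B = `|M - F B| + 1.
    by rewrite /t; field; rewrite gt_eqF.
  have := ler_norm (M - F B); lra.
rewrite l0 in yl.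
apply/cvgrPdist_lt => e e0.
have e20 : 0 < e ^+ 2 by rewrite exprn_gt0.
move/cvgrPdist_lt: yl => /(_ _ e20); apply: filterS => t.
rewrite !sub0r !normrN normrX ltr_pXn2r// nnegrE//; exact: ltW.
Unshelve. all: by end_near. Qed.

(* Complete the square in [(y ^+ 2)' = - 2 nu y ^+ 2 + 2 y h]. *)
Lemma relax_sqint nu y (h : R -> R) T : 0 < nu ->
  (forall t, T < t -> is_derive t 1 y (- nu * y t + h t)) ->
  sqint h -> sqint y.
Proof.
move=> nu0 dy [F [dF [S [M H]]]].
exists (fun t => nu^-1 * (nu^-1 * F t - y t ^+ 2)),
  (fun t => nu^-1 * (nu^-1 * dF t - 2 * y t * (- nu * y t + h t))),
  (Num.max T S), (nu^-1 * (nu^-1 * M)) => t.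
rewrite gt_max => /andP[/dy ? /H[H1 H2 H3]].
have ni0 : 0 < nu^-1 by rewrite invr_gt0.
split.
- by dereq; ring.
- rewrite -(ler_pM2l nu0) mulVKf ?gt_eqF//.
  have : nu^-1 * h t ^+ 2 <= nu^-1 * dF t by rewrite ler_pM2l.
  have : 0 <= nu^-1 * (nu * y t - h t) ^+ 2 by rewrite mulr_ge0 ?sqr_ge0// ltW.
  have -> : nu^-1 * (nu * y t - h t) ^+ 2 =
    nu * y t ^+ 2 - 2 * y t * h t + nu^-1 * h t ^+ 2 by field; rewrite gt_eqF.
  nra.
- rewrite ler_pM2l// lerBlDr; apply: (@le_trans _ _ (nu^-1 * M)); first by rewrite ler_pM2l.
  by rewrite lerDl sqr_ge0.
Qed.

End SquareIntegrable.

(** * The stable scalar delay equation *)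

Section DelayStable.
Variable R : realType.
Implicit Types (f g F y : R -> R) (t a b c d mu r : R).

(** [J] is an antiderivative of the energy density. The lower bound is the energy of the sinusoid of
    frequency [mu] with the same end values as [y], computed by parts as a boundary term. *)
Lemma dirichlet_energy_ge mu r y (dy J : R -> R) :
  0 < mu -> 0 < r -> mu * r < pi / 2 ->
  (forall x, 0 <= x <= r -> is_derive x 1 y (dy x)) ->
  (forall x, 0 <= x <= r ->
     is_derive x 1 J (dy x ^+ 2 - mu ^+ 2 * y x ^+ 2)) ->
  mu * ((y 0 ^+ 2 + y r ^+ 2) * cos (mu * r) - 2 * y 0 * y r) / sin (mu * r)
  <= J r - J 0.
Proof.
move=> mu0 r0 mur ydy dJ.
set c := cos _; set s := sin _.
have mur0 : 0 < mu * r by rewrite mulr_gt0.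
have s0 : 0 < s by apply: sin_gt0_pi; rewrite mur0/= (lt_trans mur)//; have := pi_gt0 R; lra.
pose A := y 0; pose B := (y r - y 0 * c) / s.
pose h x := A * cos (mu * x) + B * sin (mu * x).
pose h' x := mu * (B * cos (mu * x) - A * sin (mu * x)).
(* [y] minus its interpolant [h] vanishes at both ends, and [- mu tan (mu x)] solves the
   Riccati equation that makes the derivative of [Psi] a square. *)
pose Psi x := J x - 2 * (y x - h x) * h' x - h x * h' x
  + mu * tan (mu * x) * (y x - h x) ^+ 2.
pose dPsi x := (dy x - h' x + mu * tan (mu * x) * (y x - h x)) ^+ 2.
have cs : c ^+ 2 + s ^+ 2 = 1 by rewrite cos2Dsin2.
have H : Psi 0 <= Psi r.
  apply: (@derive_ge0_le _ Psi dPsi); first exact: ltW.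
    move=> x xr; have Hy := ydy _ xr; have HJ := dJ _ xr.
    have dh : is_derive x 1 h (h' x) by rewrite /h /h'; dereq; ring.
    have dh' : is_derive x 1 h' (- mu ^+ 2 * h x) by rewrite /h /h'; dereq; ring.
    have cx : cos (mu * x) != 0.
      move/andP: xr => [x0 xr]; rewrite gt_eqF// cos_gt0_pihalf//.
      have : mu * x <= mu * r by rewrite ler_pM2l.
      have : 0 <= mu * x by rewrite mulr_ge0// ltW.
      by have := pi_gt0 R; lra.
    rewrite /Psi; dereq => //; rewrite /dPsi; ring.
  by move=> x _; exact: sqr_ge0.
have h0 : h 0 = y 0 by rewrite /h mulr0 cos0 sin0 mulr1 mulr0 addr0.
have hr : h r = y r.
  by rewrite /h -/c -/s /A /B divfK ?gt_eqF// addrC subrK.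
move: H; rewrite /Psi h0 hr !subrr !mulr0 !mul0r expr0n/= !mulr0 !addr0 !subr0.
rewrite /h' -/c -/s mulr0 cos0 sin0 /A /B => H.
suff -> : mu * ((y 0 ^+ 2 + y r ^+ 2) * c - 2 * y 0 * y r) / s =
  y r * (mu * ((y r - y 0 * c) / s * c - y 0 * s)) -
  y 0 * (mu * ((y r - y 0 * c) / s * 1 - y 0 * 0)) by lra.
have sn0 : s != 0 by rewrite gt_eqF.
apply: (mulIf sn0); rewrite mulfVK//.
transitivity (mu * (y r * ((y r - y 0 * c) * c - y 0 * s ^+ 2)
   - y 0 * (y r - y 0 * c))); last by field; rewrite gt_eqF.
have -> : s ^+ 2 = 1 - c ^+ 2 by rewrite -cs; ring.
ring.
Qed.

Lemma sqr_increment_le (phi dphi G dG : R -> R) a b : a < b ->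
  (forall t, a <= t <= b -> is_derive t 1 phi (dphi t)) ->
  (forall t, a <= t <= b -> is_derive t 1 G (dG t)) ->
  (forall t, a <= t <= b -> dphi t ^+ 2 <= dG t) ->
  (phi b - phi a) ^+ 2 <= (b - a) * (G b - G a).
Proof.
move=> ab dp dg le.
have ab0 : 0 < b - a by rewrite subr_gt0.
set D := phi b - phi a.
(* Cauchy-Schwarz, by the tangent line of the square at the mean slope [k]. *)
pose k := D / (b - a).
pose L t := G t - (2 * k * phi t - k ^+ 2 * t).
have H : L a <= L b.
  apply: (@derive_ge0_le _ L (fun t => dG t - (2 * k * dphi t - k ^+ 2))).
  - exact: ltW.
  - by move=> t tab; have := dp _ tab; have := dg _ tab => ? ?; rewrite /L; dereq; ring.
  - by move=> t /le; have := sqr_ge0 (dphi t - k); lra.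
rewrite /L in H.
have : 2 * k * D - k ^+ 2 * (b - a) <= G b - G a by rewrite /D; lra.
rewrite -(ler_pM2l ab0); apply: le_trans.
by rewrite le_eqVlt; apply/orP; left; apply/eqP; rewrite /k; field; rewrite gt_eqF.
Qed.

Lemma delay_sqint mu r y f T : 0 < mu -> 0 <= r -> mu * r < pi / 2 ->
  (forall t, T < t -> is_derive t 1 y (- mu * y (t - r) + f t)) ->
  (forall t, T < t -> {for t, continuous f}) ->
  sqint f -> sqint y.
Proof.
move=> mu0 r0 mur dy cf f2.
(* Without delay this is plain relaxation; below, [r > 0] makes [sin (mu * r)] positive. *)
have [re0|rn0] := eqVneq r 0.
  by apply: (relax_sqint mu0 _ f2) => t /dy; rewrite re0 subr0.
have {r0 rn0} r0 : 0 < r by rewrite lt_neqAle eq_sym rn0.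
have mur0 : 0 < mu * r by rewrite mulr_gt0.
set c := cos (mu * r); set s := sin (mu * r).
have s0 : 0 < s by apply: sin_gt0_pi; rewrite mur0/= (lt_trans mur)//; have := pi_gt0 R; lra.
have c0 : 0 < c by apply: cos_gt0_pihalf; have := pi_gt0 R; lra.
have cs : c ^+ 2 + s ^+ 2 = 1 by rewrite cos2Dsin2.
have s1 : s < 1 by nra.
have cs1 : 1 <= c + s by nra.
pose dY t := - mu * y (t - r) + f t.
have cdY t : T + r < t -> {for t, continuous dY}.
  move=> Tt; apply: cvgD; last by apply: cf; lra.
  apply: cvgM; first exact: cvg_cst.
  by apply: (der_continuous (a := dY (t - r))); der; apply: dy; lra.
have [J dJ] : exists J : R -> R, forall t, T + r + 1 < t ->
    is_derive t 1 J (dY t ^+ 2 - mu ^+ 2 * y t ^+ 2).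
  apply: (@antiderivative _ (fun t => dY t ^+ 2 - mu ^+ 2 * y t ^+ 2) (T + r)).
    by rewrite ltrDl.
  move=> t Tt; have H1 := cdY _ Tt.
  have H2 : {for t, continuous y} by apply: der_continuous; apply: dy; lra.
  apply: cvgB; first by apply: cvgM.
  by apply: cvgM; [exact: cvg_cst|exact: cvgM].
pose g t := mu * y t - dY (t - r).
have [F [dF [S [M HF]]]] := f2.
pose S1 := Num.max S (T + r + 1).
pose V t := J t - J (t - r) + 2 * mu * y t * y (t - r).
have S1P t : S1 + r < t -> [/\ S < t, T + r + 1 < t, T + r + 1 < t - r & T < t - r].
  rewrite /S1 -ltrBrDr gt_max => /andP[? ?]; split; lra.
have V0 t : S1 + r < t -> 0 <= V t.
  move=> /S1P[St Tt Tr _].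
  (* Translation carries the window from [t - r] to [t] onto the interval from [0] to [r]. *)
  have dY' x : 0 <= x <= r -> is_derive x 1 (fun x => y (x - (r - t))) (dY (x - (r - t))).
    by move=> /andP[x0 xr]; der; apply: dy; lra.
  have dJ' x : 0 <= x <= r -> is_derive x 1 (fun x => J (x - (r - t)))
      (dY (x - (r - t)) ^+ 2 - mu ^+ 2 * y (x - (r - t)) ^+ 2).
    by move=> /andP[x0 xr]; der; apply: dJ; lra.
  have := dirichlet_energy_ge mu0 r0 mur dY' dJ'.
  rewrite -/c -/s (_ : r - (r - t) = t); last by ring.
  rewrite (_ : 0 - (r - t) = t - r); last by ring.
  rewrite /V; set p := y t; set q := y (t - r) => H.
  suff : 0 <= mu * ((q ^+ 2 + p ^+ 2) * c - 2 * q * p) / s + 2 * mu * p * q by lra.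
  have -> : mu * ((q ^+ 2 + p ^+ 2) * c - 2 * q * p) / s + 2 * mu * p * q =
    mu / s * ((q ^+ 2 + p ^+ 2) * c - 2 * (1 - s) * (p * q)).
    by field; rewrite gt_eqF.
  apply: mulr_ge0; first by rewrite divr_ge0 ?ltW.
  (* The quadratic form is diagonal in [p - q] and [p + q]; its coefficients are nonnegative by
     [s < 1], [c > 0] and [c + s >= 1]. *)
  have -> : (q ^+ 2 + p ^+ 2) * c - 2 * (1 - s) * (p * q) =
    (c + 1 - s) / 2 * (p - q) ^+ 2 + (c + s - 1) / 2 * (p + q) ^+ 2 by field.
  by rewrite addr_ge0// mulr_ge0 ?sqr_ge0//; lra.
have dV t : S1 + r < t -> is_derive t 1 V (f t ^+ 2 - g t ^+ 2).
  move=> /S1P[St Tt Tr Tr']; rewrite /V.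
  have H1 := dJ _ Tt; have H2 := dJ _ Tr; have H3 : is_derive t 1 y (dY t) by apply: dy; lra.
  have H4 := dy _ Tr'.
  by dereq; rewrite /g /dY; ring.
(* [G] witnesses the square integrability of [f] and [g] together: [V >= 0] bounds it above, and its
   derivative dominates [f ^+ 2 + g ^+ 2]. *)
pose G t := 2 * F t - V t; pose dG t := 2 * dF t - (f t ^+ 2 - g t ^+ 2).
have GP t : S1 + r < t -> [/\ is_derive t 1 G (dG t),
    f t ^+ 2 + g t ^+ 2 <= dG t & G t <= 2 * M].
  move=> St; have := dV _ St; have := V0 _ St.
  have /S1P[/HF[? ? ?] _ _ _] := St => *; split.
  - by rewrite /G /dG; dereq; ring.
  - by rewrite /dG; lra.
  - by rewrite /G; lra.
have [H dH] : exists H : R -> R, forall t, S1 + r + 1 < t -> is_derive t 1 H (G t).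
  apply: (@antiderivative _ _ (S1 + r)); first by rewrite ltrDl.
  by move=> t /GP[? _ _]; exact: der_continuous.
pose e t := c * y t - (1 - s) * y (t - r).
have e2 : sqint e.
  (* By Cauchy-Schwarz [e ^+ 2] is at most [r] times the increment of [G] over one delay, and [H] is
     an antiderivative of [G]. *)
  exists (fun t => r * (H t - H (t - r))), (fun t => r * (G t - G (t - r))),
    (S1 + r + 1 + r), (r * (r * (2 * M))) => t St; split.
  - have ? : is_derive t 1 H (G t) by apply: dH; lra.
    have ? : is_derive (t - r) 1 H (G (t - r)) by apply: dH; lra.
    by dereq; ring.
  (* [f] and [g] drive the rotation of [(y, y(t - r))] over the last delay. *)
  - pose C z := cos (mu * z); pose Sn z := sin (mu * z).
    have dC (z : R) : is_derive z 1 C (- (mu * Sn z)) by exact: der_cos.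
    have dS (z : R) : is_derive z 1 Sn (mu * C z) by exact: der_sin.
    pose phi x := y x * C (x - (t - r)) + y (x - r) * Sn (x - (t - r)).
    pose dphi x := f x * C (x - (t - r)) - g x * Sn (x - (t - r)).
    have -> : e t = phi t - phi (t - r).
      rewrite /phi /C /Sn subrr mulr0 cos0 sin0 (_ : t - (t - r) = r); last by ring.
      by rewrite /e -/c -/s; ring.
    have -> : r = t - (t - r) by ring.
    have -> : t - (t - (t - r)) = t - r by ring.
    apply: (@sqr_increment_le _ dphi _ dG); first lra.
    + move=> x /andP[x1 x2].
      have /S1P[_ _ _ Tr] : S1 + r < x by lra.
      have H1 : is_derive x 1 y (dY x) by apply: dy; lra.
      have H2 := dy _ Tr; have H3 := dC (x - (t - r)); have H4 := dS (x - (t - r)).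
      by rewrite /phi; dereq; rewrite /dphi /g /dY; ring.
    + by move=> x /andP[x1 x2]; have [] := GP x (ltac:(lra)).
    + move=> x /andP[x1 x2]; have [_ + _] := GP x (ltac:(lra)); apply: le_trans.
      rewrite /dphi /C /Sn.
      have := cos2Dsin2 (mu * (x - (t - r))); set cx := cos _; set sx := sin _ => cs'.
      have := sqr_ge0 (f x * sx + g x * cx).
      have -> : f x ^+ 2 + g x ^+ 2 = (f x ^+ 2 + g x ^+ 2) * (cx ^+ 2 + sx ^+ 2).
        by rewrite cs' mulr1.
      nra.
  - rewrite ler_pM2l//.
    pose L x := 2 * M * x - H x.
    have : L (t - r) <= L t.
      apply: (@derive_ge0_le _ L (fun x => 2 * M - G x)); first lra.
      + by move=> x /andP[x1 x2]; have := dH x (ltac:(lra)) => ?; rewrite /L; dereq; ring.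
      + by move=> x /andP[x1 x2]; have [_ _ +] := GP x (ltac:(lra)); lra.
    rewrite /L; lra.
(* Solving the definition of [e] for [y (t - r)] turns the delay equation into an undelayed
   relaxation with this rate, forced by [e] and [f]. *)
have k0 : 0 < mu * c / (1 - s) by rewrite divr_gt0 ?mulr_gt0 ?subr_gt0.
pose h t := mu / (1 - s) * e t + f t.
have h2 : sqint h by apply: sqintD => //; exact: sqintZ.
have dy' t : T < t -> is_derive t 1 y (- (mu * c / (1 - s)) * y t + h t).
  move=> /dy Hy; apply: (der_eq Hy); rewrite /h /e; field.
  by rewrite subr_eq0 gt_eqF.
exact: (relax_sqint k0 dy' h2).
Qed.

End DelayStable.

(** * Spectrum and averages of a layer *)

Section RealSpectral.
Import complex.
Variable R : rcfType.
Local Notation C := (complex R).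

Lemma Re_mulmx m n p (X : 'M[C]_(m, n)) (Y : 'M[C]_(n, p)) :
  map_mx (@Re R) (X *m Y) =
  map_mx (@Re R) X *m map_mx (@Re R) Y - map_mx (@Im R) X *m map_mx (@Im R) Y.
Proof.
apply/matrixP => i j; rewrite !mxE (big_morph (@Re R) (id1 := 0) (op1 := +%R))//.
  rewrite -sumrB; apply: eq_bigr => k _; rewrite !mxE.
  by case: (X i k) => ? ?; case: (Y k j).
by case=> ? ? [].
Qed.

Lemma Im_mulmx m n p (X : 'M[C]_(m, n)) (Y : 'M[C]_(n, p)) :
  map_mx (@Im R) (X *m Y) =
  map_mx (@Re R) X *m map_mx (@Im R) Y + map_mx (@Im R) X *m map_mx (@Re R) Y.
Proof.
apply/matrixP => i j; rewrite !mxE (big_morph (@Im R) (id1 := 0) (op1 := +%R))//.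
  rewrite -big_split; apply: eq_bigr => k _; rewrite !mxE.
  by case: (X i k) => ? ?; case: (Y k j).
by case=> ? ? [].
Qed.

(** Conjugation by the square roots of [d] makes [M] symmetric, and the complex spectral theorem
    gives a unitary eigenbasis with real eigenvalues. The real and imaginary parts of its rows are
    then real left eigenvectors or zero; stacking both gives [n + n] rows, and the real part of the
    inverse relation gives [Q]. *)
Lemma weighted_symmetric_spectral n (d : 'I_n -> R) (M : 'M[R]_n) :
  (forall i, 0 < d i) -> (forall i j, d i * M i j = d j * M j i) ->
  exists (Q : 'M[R]_(n, n + n)) (P : 'M[R]_(n + n, n)) (mu : 'I_(n + n) -> R),
    Q *m P = 1%:M /\ forall i, row i P *m M = mu i *: row i P.
Proof.
move=> d0 dM.
pose rd : 'rV[R]_n := \row_i Num.sqrt (d i).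
pose ri : 'rV[R]_n := \row_i (Num.sqrt (d i))^-1.
have rd0 i : Num.sqrt (d i) != 0 by rewrite gt_eqF// sqrtr_gt0.
have rdri : diag_mx ri *m diag_mx rd = 1%:M.
  apply/matrixP => i j; rewrite mul_diag_mx !mxE.
  by have [->|] := eqVneq i j; rewrite ?mulr0// mulVf.
pose S := diag_mx rd *m M *m diag_mx ri.
have Ssym : S^T = S.
  apply/matrixP => i j; rewrite /S mxE !mul_mx_diag !mul_diag_mx !mxE.
  have H : Num.sqrt (d i) ^+ 2 * M i j = Num.sqrt (d j) ^+ 2 * M j i.
    by rewrite (sqr_sqrtr (ltW (d0 i))) (sqr_sqrtr (ltW (d0 j))).
  apply: (mulfI (rd0 i)); apply: (mulfI (rd0 j)).
  transitivity (Num.sqrt (d j) ^+ 2 * M j i); first by field.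
  by rewrite -H; field.
pose A := map_mx (real_complex R) S.
have Aherm : A \is hermsymmx.
  apply: realsym_hermsym.
    apply/is_hermitianmxP; rewrite expr0 scale1r map_mx_id//.
    by rewrite /A -{1}Ssym; move: (S) => X; apply/matrixP => i j; rewrite !mxE.
  by apply/mxOverP => i j; rewrite mxE; apply/complex_realP; exists (S i j).
have Anorm := hermitian_normalmx Aherm.
have Dreal := hermitian_spectral_diag_real Aherm.
have := orthomx_spectralP Anorm.
set U := spectralmx A; set sp := spectral_diag A => AE.
have UU := spectral_unit A.
pose mu i := Re (sp 0 i).
have muE i : sp 0 i = real_complex R (mu i).
  by rewrite /mu RRe_real//; apply: (mxOverP Dreal).
have UA : U *m A = diag_mx sp *m U by rewrite AE !mulmxA mulmxV// mul1mx.
pose D := diag_mx (\row_i mu i).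
have spE : diag_mx sp = map_mx (real_complex R) D.
  apply/matrixP => i j; rewrite !mxE muE.
  by case: (i == j); rewrite ?mulr1n ?mulr0n ?rmorph0.
have ReC m k (X : 'M[R]_(m, k)) : map_mx (@Re R) (map_mx (real_complex R) X) = X.
  by apply/matrixP => i j; rewrite !mxE.
have ImC m k (X : 'M[R]_(m, k)) : map_mx (@Im R) (map_mx (real_complex R) X) = 0.
  by apply/matrixP => i j; rewrite !mxE.
pose Ur := map_mx (@Re R) U; pose Ui := map_mx (@Im R) U.
have SD : diag_mx rd *m M = S *m diag_mx rd.
  by rewrite /S -[_ *m diag_mx ri *m _]mulmxA rdri mulmx1.
have UrS : Ur *m S = D *m Ur.
  have := congr1 (map_mx (@Re R)) UA; rewrite spE /A !Re_mulmx !ReC !ImC.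
  by rewrite mulmx0 mul0mx !subr0.
have UiS : Ui *m S = D *m Ui.
  have := congr1 (map_mx (@Im R)) UA; rewrite spE /A !Im_mulmx !ReC !ImC.
  by rewrite mulmx0 mul0mx add0r addr0.
pose V := invmx U.
exists (row_mx (diag_mx ri *m map_mx (@Re R) V) (- (diag_mx ri *m map_mx (@Im R) V))).
exists (col_mx (Ur *m diag_mx rd) (Ui *m diag_mx rd)).
exists (fun i => match fintype.split i with inl j => mu j | inr j => mu j end).
have rowD (X : 'M[R]_n) j : row j (D *m X) = mu j *: row j X.
  by rewrite /D mul_diag_mx; apply/rowP => k; rewrite !mxE.
split.
  have VU : map_mx (@Re R) V *m Ur - map_mx (@Im R) V *m Ui = 1%:M.
    rewrite -Re_mulmx mulVmx//; apply/matrixP => i j; rewrite !mxE.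
    by case: (i == j).
  rewrite mul_row_col mulNmx.
  transitivity (diag_mx ri *m (map_mx (@Re R) V *m Ur - map_mx (@Im R) V *m Ui)
    *m diag_mx rd); first by rewrite mulmxBr mulmxBl !mulmxA.
  by rewrite VU mulmx1.
move=> i; case: fintype.splitP => j ij.
  have -> : i = lshift n j by exact: val_inj.
  by rewrite rowKu -row_mul -mulmxA SD mulmxA UrS -mulmxA rowD.
have -> : i = rshift n j by exact: val_inj.
by rewrite rowKd -row_mul -mulmxA SD mulmxA UiS -mulmxA rowD.
Qed.

End RealSpectral.

(** * Laplacian, group averages and left eigenvectors of one layer *)

Section LayerAlgebra.
Variables (R : rcfType) (n m : nat) (g : 'I_n -> 'I_m) (adj : rel 'I_n).
Hypothesis g_surj : forall p, exists i, g i = p.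
Hypothesis adjP : groupwise_connected_graph g adj.
Variable a : 'I_n -> R.
Hypothesis a_gt0 : forall i, 0 < a i.
Local Notation L := (laplacian R adj).
Local Notation B := (group_B R g).
Local Notation a' := (agg_weights g a).
Local Notation M := (Kmat a *m L).
(** The averages are weighted by [a], which makes this left inverse of [B] annihilate [M] from the
    left. *)
Definition group_avg : 'M[R]_(m, n) := Kmat a' *m B^T *m diag_mx (\row_i a i).
Local Notation P := group_avg.

Lemma agg_weights_gt0 p : 0 < a' p.
Proof.
have [i gi] := g_surj p; rewrite /agg_weights (bigD1 i) ?gi//= ltr_pwDl//.
by apply: sumr_ge0 => j _; exact: ltW.
Qed.

Lemma laplacianE i j : L i j = (i == j)%:R * \sum_k (adj i k)%:R - (adj i j)%:R.
Proof.
have [[_ irr] _] := adjP; rewrite mxE; have [->|_] := eqVneq i j.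
  rewrite (negbTE (irr j)) subr0 mul1r -sum1_card natr_sum big_mkcond/=.
  by apply: eq_bigr => k _; rewrite inE; case: (adj j k).
by rewrite mul0r sub0r.
Qed.

Lemma laplacian_sym i j : L i j = L j i.
Proof.
have [[sym _] _] := adjP; rewrite !laplacianE sym eq_sym.
by have [->|] := eqVneq j i; rewrite ?mul0r.
Qed.

Lemma tr_laplacian : L^T = L.
Proof. by apply/matrixP => i j; rewrite mxE laplacian_sym. Qed.

Lemma sum_delta i (F : 'I_n -> R) : \sum_j (i == j)%:R * F j = F i.
Proof.
rewrite (bigD1 i)//= eqxx mul1r big1 ?addr0// => j ji.
by rewrite eq_sym (negbTE ji) mul0r.
Qed.

Lemma laplacian_B : L *m B = 0.
Proof.
have [_ [same _]] := adjP.
apply/matrixP => i p; rewrite !mxE.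
under eq_bigr do rewrite laplacianE mulrBl -mulrA mxE.
rewrite sumrB sum_delta.
apply/eqP; rewrite subr_eq0 big_distrl/=; apply/eqP/eq_bigr => j _.
by case: (boolP (adj i j)) => [/same ->|]; rewrite ?mul0r.
Qed.

Lemma Kmat_laplacian_group_B : M *m B = 0.
Proof. by rewrite -mulmxA laplacian_B mulmx0. Qed.

Lemma diag_Kmat : diag_mx (\row_i a i) *m Kmat a = 1%:M.
Proof.
apply/matrixP => i j; rewrite mul_diag_mx !mxE.
by have [->|] := eqVneq i j; rewrite ?mulr0// mulr1n mulfV// gt_eqF.
Qed.

Lemma Kmat_diag : Kmat a *m diag_mx (\row_i a i) = 1%:M.
Proof. exact: mulmx1C diag_Kmat. Qed.

Lemma group_avg_laplacian : P *m M = 0.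
Proof.
rewrite /P -!mulmxA (mulmxA _ _ L) diag_Kmat mul1mx -tr_laplacian -trmx_mul.
by rewrite laplacian_B trmx0 mulmx0.
Qed.

Lemma group_avg_group_B : P *m B = 1%:M.
Proof.
rewrite /P -!mulmxA; apply/matrixP => p q; rewrite mul_diag_mx !mxE.
under eq_bigr => i _ do rewrite mul_diag_mx !mxE.
have [->|pq] := eqVneq p q.
  rewrite (_ : \sum_i _ = a' q) ?mulVf ?gt_eqF ?agg_weights_gt0//.
  rewrite /agg_weights [RHS]big_mkcond; apply: eq_bigr => i _.
  by case: (g i == q); rewrite ?mul0r// mul1r mulr1.
rewrite big1 ?mulr0// => i _; have [->|] := eqVneq (g i) p; last by rewrite mul0r.
by rewrite (negbTE pq) !mulr0.
Qed.

(** The Dirichlet form of the graph. The factor 2 appears because the double sum meets each edge in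
    both orientations. *)
Lemma laplacian_quad (v : 'rV[R]_n) :
  (v *m L *m v^T) 0 0 * 2 = \sum_i \sum_j (adj i j)%:R * (v 0 i - v 0 j) ^+ 2.
Proof.
have [[sym _] _] := adjP.
have -> : (v *m L *m v^T) 0 0 =
    \sum_i \sum_j (adj i j)%:R * (v 0 i ^+ 2 - v 0 i * v 0 j).
  rewrite -mulmxA mxE; apply: eq_bigr => i _; rewrite mxE.
  under eq_bigr => j _ do rewrite laplacianE mulrBl -mulrA mxE.
  rewrite sumrB sum_delta.
  rewrite big_distrl/= -sumrB big_distrr/=; apply: eq_bigr => j _; ring.
rewrite mulr_natr mulr2n.
have {2}-> : \sum_i \sum_j (adj i j)%:R * (v 0 i ^+ 2 - v 0 i * v 0 j) =
    \sum_i \sum_j (adj i j)%:R * (v 0 j ^+ 2 - v 0 i * v 0 j).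
  rewrite exchange_big; apply: eq_bigr => i _; apply: eq_bigr => j _.
  by rewrite sym; ring.
rewrite -big_split; apply: eq_bigr => i _; rewrite -big_split.
by apply: eq_bigr => j _ /=; ring.
Qed.

Lemma laplacian_quad_ge0 (v : 'rV[R]_n) : 0 <= (v *m L *m v^T) 0 0.
Proof.
rewrite -(pmulr_lge0 _ (ltr0n R 2)) laplacian_quad.
by apply: sumr_ge0 => i _; apply: sumr_ge0 => j _; rewrite mulr_ge0 ?ler0n ?sqr_ge0.
Qed.

(** Every edge term vanishes, so [v] is constant along paths, and each group is connected. *)
Lemma laplacian_quad_eq0 (v : 'rV[R]_n) : (v *m L *m v^T) 0 0 = 0 ->
  forall i j, g i = g j -> v 0 i = v 0 j.
Proof.
have [_ [_ conn]] := adjP.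
move=> v0; have := laplacian_quad v; rewrite v0 mul0r => /esym/eqP.
rewrite psumr_eq0 => [/allP H|i _]; last first.
  by apply: sumr_ge0 => j _; rewrite mulr_ge0 ?ler0n ?sqr_ge0.
have adjv i j : adj i j -> v 0 i = v 0 j.
  move=> ij; have /implyP/(_ isT) := H i (mem_index_enum _).
  rewrite psumr_eq0 => [/allP/(_ j (mem_index_enum _))|k _]; last first.
    by rewrite mulr_ge0 ?ler0n ?sqr_ge0.
  by rewrite ij/= mul1r sqrf_eq0 subr_eq0 => /eqP.
move=> i j /conn/connectP[p]; elim: p i => [i _ ->//|k p IH i /= /andP[/adjv -> kp]].
exact: IH.
Qed.

(** After rescaling by [Kmat a], a left null vector is constant on groups, hence [l] is a
    combination of rows of [P]. Null modes therefore do not see states with zero group averages. *)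
Lemma left_kernel_avg (l : 'rV[R]_n) : l *m M = 0 -> l *m (1%:M - B *m P) = 0.
Proof.
move=> lM; have [v vdef] : exists v, v = l *m Kmat a by eexists.
have vL : v *m L = 0 by rewrite vdef -mulmxA.
have vg := laplacian_quad_eq0 (v := v); rewrite vL mul0mx mxE in vg.
have {}vg := vg erefl.
(* A representative node of each group, at which the common value of [v] is read off. *)
pose r p := sval (cid (g_surj p)).
have gr p : g (r p) = p by rewrite /r; case: cid.
pose c : 'rV[R]_m := \row_p v 0 (r p).
have vE : v = c *m B^T.
  apply/rowP => i; rewrite mxE (bigD1 (g i))//= !mxE eqxx mulr1 big1 ?addr0.
    by apply: vg; rewrite gr.
  by move=> p pi; rewrite !mxE eq_sym (negbTE pi) mulr0.
have lE : l = c *m diag_mx (\row_p a' p) *m P.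
  rewrite /P !mulmxA -(mulmxA c) (_ : diag_mx _ *m Kmat a' = 1%:M) ?mulmx1.
    by rewrite -vE vdef -mulmxA Kmat_diag mulmx1.
  apply/matrixP => i j; rewrite mul_diag_mx !mxE.
  by have [->|] := eqVneq i j; rewrite ?mulr0// mulr1n mulfV// gt_eqF// agg_weights_gt0.
suff lBP : l *m (B *m P) = l by rewrite mulmxBr mulmx1 lBP subrr.
by rewrite lE -mulmxA (mulmxA P) group_avg_group_B mul1mx.
Qed.

(** For [v = l *m Kmat a], [mu] is the Rayleigh quotient of the Laplacian with respect to the inner
    product weighted by [a]. *)
Lemma eigenvalue_Kmat_laplacian_ge0 (l : 'rV[R]_n) mu : l != 0 -> l *m M = mu *: l -> 0 <= mu.
Proof.
move=> l0 lM; have [v vdef] : exists v, v = l *m Kmat a by eexists.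
have vL : v *m L = mu *: (v *m diag_mx (\row_i a i)).
  by rewrite vdef -!mulmxA Kmat_diag mulmx1.
have := laplacian_quad_ge0 v; rewrite vL -scalemxAl mxE.
rewrite pmulr_lge0// mxE.
under eq_bigr => i _ do rewrite mul_mx_diag !mxE.
have sq i : 0 <= v 0 i * a i * v 0 i.
  by rewrite mulrAC -expr2 mulr_ge0 ?sqr_ge0// ltW.
have le : 0 <= \sum_i v 0 i * a i * v 0 i by apply: sumr_ge0.
rewrite lt_neqAle le andbT eq_sym; apply: contra l0.
rewrite psumr_eq0// => /allP H; apply/eqP/rowP => i.
have /implyP/(_ isT) := H i (mem_index_enum _).
rewrite mulrAC -expr2 mulf_eq0 (gt_eqF (a_gt0 i)) orbF sqrf_eq0.
rewrite vdef /Kmat mul_mx_diag !mxE mulf_eq0 invr_eq0 (gt_eqF (a_gt0 i)) orbF.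
by move/eqP.
Qed.

Lemma Kmat_laplacian_spectral :
  exists (k : nat) (Q : 'M[R]_(n, k)) (E : 'M[R]_(k, n)) (mu : 'I_k -> R),
    Q *m E = 1%:M /\ forall i, row i E *m M = mu i *: row i E.
Proof.
have ME i j : M i j = (a i)^-1 * L i j by rewrite mul_diag_mx !mxE.
have [i j|Q [E [mu H]]] := weighted_symmetric_spectral (M := M) a_gt0.
  by rewrite !ME !mulVKf ?gt_eqF// laplacian_sym.
by exists (n + n)%N, Q, E, mu.
Qed.

End LayerAlgebra.

(** * Vector-valued calculus *)

Section VectorCalculus.
Variable R : realType.
Implicit Types t : R.

Lemma der_mxP m n (z : R -> 'M[R]_(m, n)) t (d : 'M[R]_(m, n)) :
  is_derive t 1 z d <-> forall i j, is_derive t 1 (fun x => z x i j) (d i j).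
Proof.
split=> [[zt zd] i j|H].
  have H := (derivable_mxP z t 1).1 zt.
  by apply: DeriveDef => //; rewrite -zd derive_mx// mxE.
have zt : derivable z t 1 by apply/derivable_mxP => i j; have [] := H i j.
apply: (DeriveDef zt); rewrite derive_mx//.
by apply/matrixP => i j; rewrite mxE; have [] := H i j.
Qed.

Lemma der_sum (I : Type) (r : seq I) (f : I -> R -> R) (d : I -> R) t :
  (forall i, is_derive t 1 (f i) (d i)) ->
  is_derive t 1 (fun x => \sum_(i <- r) f i x) (\sum_(i <- r) d i).
Proof.
move=> H; elim: r => [|i r IH].
  by rewrite big_nil; under eq_fun do rewrite big_nil; exact: der_cst.
by rewrite big_cons; under eq_fun do rewrite big_cons; exact: derD.
Qed.

Lemma der_mulmx m n p (A : 'M[R]_(m, n)) (z : R -> 'M[R]_(n, p)) t (d : 'M[R]_(n, p)) :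
  is_derive t 1 z d -> is_derive t 1 (fun x => A *m z x) (A *m d).
Proof.
move=> /der_mxP H; apply/der_mxP => i j; rewrite mxE.
under eq_fun do rewrite mxE.
by apply: der_sum => k; have := H k j => ?; dereq; ring.
Qed.

Lemma der_mx_shift m n (z : R -> 'M[R]_(m, n)) c t (d : 'M[R]_(m, n)) :
  is_derive (t - c) 1 z d -> is_derive t 1 (fun x => z (x - c)) d.
Proof.
move=> /der_mxP H; apply/der_mxP => i j.
exact: (der_shift (f := fun x => z x i j)).
Qed.

Lemma cvg_mxP m n (z : R -> 'M[R]_(m, n)) (F : set_system R) {FF : Filter F}
    (l : 'M[R]_(m, n)) :
  z x @[x --> F] --> l <-> forall i j, z x i j @[x --> F] --> l i j.
Proof.
split=> [zl i j|H].
  exact: (cvg_comp z (fun M : 'M[R]_(m, n) => M i j) zl (@coord_continuous _ _ _ i j l)).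
apply/cvgrPdist_le => e e0; near=> x.
rewrite /Num.Def.normr/= mx_normrE (bigmax_le _ (ltW e0))//= => i _.
rewrite !mxE/=; move: i; near: x; apply: filter_forall => /= i.
exact: ((cvgrPdist_le _ _).1 (H i.1 i.2)).
Unshelve. all: by end_near. Qed.

Lemma cvg_mulmx m n p (A : 'M[R]_(m, n)) (z : R -> 'M[R]_(n, p))
    (F : set_system R) {FF : Filter F} (l : 'M[R]_(n, p)) :
  z x @[x --> F] --> l -> A *m z x @[x --> F] --> A *m l.
Proof.
move=> /cvg_mxP H; apply/cvg_mxP => i j; rewrite mxE.
under eq_fun do rewrite mxE.
apply: cvg_big => [|k _]; first exact: add_continuous.
by apply: cvgM; [exact: cvg_cst|exact: H].
Qed.

Definition vsqint n (z : R -> 'cV[R]_n) := forall i, sqint (fun t => z t i 0).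

Lemma vsqint_near n (z z' : R -> 'cV[R]_n) T :
  (forall t, T < t -> z t = z' t) -> vsqint z -> vsqint z'.
Proof. by move=> H zs i; apply: sqint_near (zs i) => t /H ->. Qed.

Lemma vsqint0 n : vsqint (fun=> 0 : 'cV[R]_n).
Proof. by move=> i; apply: (sqint_near (T := 0) _ (sqint0 R)) => t _; rewrite mxE. Qed.

Lemma vsqintM m n (A : 'M[R]_(m, n)) (z : R -> 'cV[R]_n) :
  vsqint z -> vsqint (fun t => A *m z t).
Proof.
move=> H i; under eq_fun do rewrite mxE.
by apply: sqint_sum => k; exact: sqintZ.
Qed.

Lemma vsqintD n (z z' : R -> 'cV[R]_n) :
  vsqint z -> vsqint z' -> vsqint (fun t => z t + z' t).
Proof. by move=> H H' i; under eq_fun do rewrite mxE; exact: sqintD. Qed.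

Lemma vsqintN n (z : R -> 'cV[R]_n) : vsqint z -> vsqint (fun t => - z t).
Proof.
move=> H i; apply: (sqint_near (T := 0) _ (sqintZ (-1) (H i))) => t _.
by rewrite mxE mulN1r.
Qed.

Lemma vsqint_shift n r (z : R -> 'cV[R]_n) : vsqint z -> vsqint (fun t => z (t - r)).
Proof. by move=> H i; exact: (@sqint_shift _ r (fun t => z t i 0)). Qed.

Lemma vsqint_cvg0 n (z dz : R -> 'cV[R]_n) T :
  (forall t, T < t -> is_derive t 1 z (dz t)) ->
  vsqint z -> vsqint dz -> z t @[t --> +oo] --> (0 : 'cV[R]_n).
Proof.
move=> zd H H'; apply/cvg_mxP => i j; rewrite ord1 mxE.
apply: (@sqint_cvg0 _ _ (fun t => dz t i 0) T) (H i) (H' i) => t /zd /der_mxP.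
by apply.
Qed.

(** * Modal decomposition of one delayed layer *)

Section Layer.
Variables (n m : nat) (g : 'I_n -> 'I_m) (adj : rel 'I_n).
Hypothesis g_surj : forall p, exists i, g i = p.
Hypothesis adjP : groupwise_connected_graph g adj.
Variable a : 'I_n -> R.
Hypothesis a_gt0 : forall i, 0 < a i.
Local Notation M := (Kmat a *m laplacian R adj).

(** Each left eigenvector turns the layer into a scalar delay equation. Null modes vanish because
    [z] has zero group averages; the others have [mu > 0] and satisfy the delay bound. *)
Lemma layer_sqint T r (z f : R -> 'cV[R]_n) : 0 <= r ->
  (forall mu, 0 < mu -> eigenvalue M mu -> mu * r < pi / 2) ->
  (forall t, T < t -> is_derive t 1 z (- (M *m z (t - r)) + f t)) ->
  (forall t, T < t -> exists d : 'cV[R]_n, is_derive t 1 f d) ->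
  vsqint f -> (forall t, T < t -> group_avg g a *m z t = 0) -> vsqint z.
Proof.
move=> r0 mur dz cf f2 Pz.
have [k [Q [E [mu [QE HE]]]]] := Kmat_laplacian_spectral adjP a_gt0.
suff H : vsqint (fun t => E *m z t).
  by apply: (vsqint_near (T := T)) (vsqintM Q H) => t _; rewrite mulmxA QE mul1mx.
move=> i; pose l := row i E.
have lE (v : 'cV[R]_n) : (E *m v) i 0 = (l *m v) 0 0.
  by rewrite -row_mul [RHS]mxE.
(* A zero row of [E] carries no information, and its [mu i] need not be an eigenvalue. *)
have [l0|l0] := eqVneq l 0.
  by apply: (sqint_near (T := T) _ (sqint0 R)) => t _; rewrite lE l0 mul0mx mxE.
have lM : l *m M = mu i *: l by exact: HE.
have mu0 := eigenvalue_Kmat_laplacian_ge0 adjP a_gt0 l0 lM.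
have [mui0|mui0] := eqVneq (mu i) 0.
  rewrite mui0 scale0r in lM.
  have := left_kernel_avg g_surj adjP a_gt0 lM; rewrite mulmxBr mulmx1 => /subr0_eq H.
  apply: (sqint_near (T := T) _ (sqint0 R)) => t Tt.
  by rewrite lE H -(mulmxA l) -(mulmxA (group_B R g)) Pz// !mulmx0 mxE.
have {mu0 mui0} mu0 : 0 < mu i by rewrite lt_neqAle eq_sym mui0.
have muE : eigenvalue M (mu i) by apply/eigenvalueP; exists l.
pose q t := (E *m z t) i 0; pose h t := (E *m f t) i 0.
have dq t : T < t -> is_derive t 1 q (- mu i * q (t - r) + h t).
  move=> Tt; have /der_mxP/(_ i 0) Hq := der_mulmx E (dz _ Tt).
  apply: (der_eq Hq); rewrite mulmxDr mulmxN mxE [X in X + _]mxE; congr (_ + _).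
  by rewrite lE mulmxA lM -scalemxAl [in LHS]mxE /q lE mulNr.
have ch t : T < t -> {for t, continuous h}.
  by move=> /cf[d /(der_mulmx E)/der_mxP/(_ i 0)]; exact: der_continuous.
exact: (delay_sqint mu0 r0 (mur _ mu0 muE) dq ch (vsqintM E f2 i)).
Qed.

End Layer.
End VectorCalculus.

(** * The three-layer cascade *)

Section ThreeLayers.
Variable R : realType.
Implicit Types t : R.

(** The only analytic input to the cascade argument. The threshold [T] is quantified so that it can
    be postponed by the delays of the forcing terms. *)
Definition stable_layer n m (M : 'M[R]_n) (P : 'M[R]_(m, n)) (r : R) :=
  forall T (z f : R -> 'cV[R]_n),
  (forall t, T < t -> is_derive t 1 z (- (M *m z (t - r)) + f t)) ->
  (forall t, T < t -> exists d : 'cV[R]_n, is_derive t 1 f d) ->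
  vsqint f -> (forall t, T < t -> P *m z t = 0) -> vsqint z.

Variables (N1 N2 N3 N4 : nat).
Variables (M1 : 'M[R]_N1) (M2 : 'M[R]_N2) (M3 : 'M[R]_N3).
Variables (B1 : 'M[R]_(N1, N2)) (B2 : 'M[R]_(N2, N3)) (B3 : 'M[R]_(N3, N4)).
Variables (P1 : 'M[R]_(N2, N1)) (P2 : 'M[R]_(N3, N2)) (P3 : 'M[R]_(N4, N3)).
Variables (C1 : 'M[R]_(N2, N1)) (C2 : 'M[R]_(N3, N2)).
Variables (tau sigma : R).
Hypotheses (tau_ge0 : 0 <= tau) (sigma_ge0 : 0 <= sigma).
Hypotheses (M1B1 : M1 *m B1 = 0) (M2B2 : M2 *m B2 = 0) (M3B3 : M3 *m B3 = 0).
Hypotheses (P1M1 : P1 *m M1 = 0) (P2M2 : P2 *m M2 = 0) (P3M3 : P3 *m M3 = 0).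
Hypotheses (P1B1 : P1 *m B1 = 1%:M) (P2B2 : P2 *m B2 = 1%:M)
  (P3B3 : P3 *m B3 = 1%:M).
Hypotheses (C1B1 : C1 *m B1 = 1%:M) (C2B2 : C2 *m B2 = 1%:M).

Definition hier_field (x : R -> 'cV[R]_N1) t : 'cV[R]_N1 :=
  - (M1 *m x t) - B1 *m M2 *m C1 *m x (t - tau)
  - B1 *m B2 *m M3 *m C2 *m C1 *m x (t - sigma).

(** Each [P] annihilates the [M] of its layer and cancels the [B] that distributes the commands from
    above; this is conservation of the total weighted average. *)
Lemma avg_hier_field x t : P3 *m (P2 *m (P1 *m hier_field x t)) = 0.
Proof.
rewrite /hier_field !(mulmxDr, mulmxN, mulmxA) -(mulmxA _ P1 M1) P1M1.
rewrite mulmx0 mul0mx oppr0 add0r -!(mulmxA _ P1 B1) P1B1 !mulmx1.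
rewrite -(mulmxA _ P2 M2) P2M2 mulmx0 !mul0mx oppr0 add0r.
by rewrite -(mulmxA _ P2 B2) P2B2 mulmx1 P3M3 !mul0mx oppr0.
Qed.

Hypotheses (st1 : stable_layer M1 P1 0) (st2 : stable_layer M2 P2 tau)
  (st3 : stable_layer M3 P3 sigma).

(** Write [x = w + B1 (z + B2 (rho + B3 c))]. The deviations [w], [z], [rho] obey their layer
    equations, each forced only by the preceding ones, so square integrability passes upward and all
    three tend to 0. *)
Lemma hier_cvg (x : R -> 'cV[R]_N1) T c :
  (forall t, T < t -> is_derive t 1 x (hier_field x t)) ->
  (forall t, T < t -> P3 *m (P2 *m (P1 *m x t)) = c) ->
  x t @[t --> +oo] --> B1 *m (B2 *m (B3 *m c)).
Proof.
move=> dx cx.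
(* The projections onto deviations from the group averages. *)
pose W1 := 1%:M - B1 *m P1; pose W2 := 1%:M - B2 *m P2; pose W3 := 1%:M - B3 *m P3.
have W1B1 : W1 *m B1 = 0 by rewrite mulmxBl mul1mx -mulmxA P1B1 mulmx1 subrr.
have W1M1 : W1 *m M1 = M1 by rewrite mulmxBl mul1mx -mulmxA P1M1 mulmx0 subr0.
have M1W1 : M1 *m W1 = M1 by rewrite mulmxBr mulmx1 mulmxA M1B1 mul0mx subr0.
have P1W1 : P1 *m W1 = 0 by rewrite mulmxBr mulmx1 mulmxA P1B1 mul1mx subrr.
have W2B2 : W2 *m B2 = 0 by rewrite mulmxBl mul1mx -mulmxA P2B2 mulmx1 subrr.
have W2M2 : W2 *m M2 = M2 by rewrite mulmxBl mul1mx -mulmxA P2M2 mulmx0 subr0.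
have P2W2 : P2 *m W2 = 0 by rewrite mulmxBr mulmx1 mulmxA P2B2 mul1mx subrr.
have W3M3 : W3 *m M3 = M3 by rewrite mulmxBl mul1mx -mulmxA P3M3 mulmx0 subr0.
have P3W3 : P3 *m W3 = 0 by rewrite mulmxBr mulmx1 mulmxA P3B3 mul1mx subrr.
have W1E (y : 'cV[R]_N1) : y = W1 *m y + B1 *m (P1 *m y).
  by rewrite mulmxBl mul1mx mulmxA subrK.
have W2E (y : 'cV[R]_N2) : y = W2 *m y + B2 *m (P2 *m y).
  by rewrite mulmxBl mul1mx mulmxA subrK.
have W3E (y : 'cV[R]_N3) : y = W3 *m y + B3 *m (P3 *m y).
  by rewrite mulmxBl mul1mx mulmxA subrK.
clearbody W1 W2 W3.
pose w t := W1 *m x t; pose u t := P1 *m x t; pose z t := W2 *m u t.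
pose v t := P2 *m u t; pose rho t := W3 *m v t.
have xE t : x t = w t + B1 *m u t by exact: W1E.
have uE t : u t = z t + B2 *m v t by exact: W2E.
have vE t : v t = rho t + B3 *m (P3 *m v t) by exact: W3E.
have cv t : T < t -> P3 *m v t = c by exact: cx.
have wd t d : is_derive t 1 x d -> is_derive t 1 w (W1 *m d) by exact: der_mulmx.
have ud t d : is_derive t 1 x d -> is_derive t 1 u (P1 *m d) by exact: der_mulmx.
have zd t d : is_derive t 1 u d -> is_derive t 1 z (W2 *m d) by exact: der_mulmx.
have vd t d : is_derive t 1 u d -> is_derive t 1 v (P2 *m d) by exact: der_mulmx.
have rhod t d : is_derive t 1 v d -> is_derive t 1 rho (W3 *m d) by exact: der_mulmx.
have M1w t : M1 *m w t = M1 *m x t by rewrite /w mulmxA M1W1.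
have P1w t : P1 *m w t = 0 by rewrite /w mulmxA P1W1 mul0mx.
have P2z t : P2 *m z t = 0 by rewrite /z mulmxA P2W2 mul0mx.
have P3rho t : P3 *m rho t = 0 by rewrite /rho mulmxA P3W3 mul0mx.
clearbody w u z v rho.
(* The measurement differs from the true group average only by a term in the deviation [w]; this
   term becomes forcing for the layers above. *)
have C1x t : C1 *m x t = C1 *m w t + u t.
  by rewrite {1}xE mulmxDr (mulmxA C1 B1) C1B1 mul1mx.
have C2u t : C2 *m u t = C2 *m z t + v t.
  by rewrite {1}uE mulmxDr (mulmxA C2 B2) C2B2 mul1mx.
have M2u t : M2 *m u t = M2 *m z t.
  by rewrite {1}uE mulmxDr (mulmxA M2 B2) M2B2 mul0mx addr0.
have M3v t : M3 *m v t = M3 *m rho t.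
  by rewrite {1}vE mulmxDr (mulmxA M3 B3) M3B3 mul0mx addr0.
have dw t : T < t -> is_derive t 1 w (- (M1 *m w (t - 0)) + 0).
  move=> Tt; apply: (is_derive_eq (wd _ _ (dx _ Tt))).
  rewrite subr0 addr0 M1w /hier_field !(mulmxDr, mulmxN, mulmxA) W1M1 W1B1.
  by rewrite !mul0mx !subr0.
have du t : T < t -> is_derive t 1 u
    (- (M2 *m (C1 *m x (t - tau))) - B2 *m (M3 *m (C2 *m (C1 *m x (t - sigma))))).
  move=> Tt; apply: (is_derive_eq (ud _ _ (dx _ Tt))).
  rewrite /hier_field !(mulmxDr, mulmxN, mulmxA) P1M1 P1B1.
  by rewrite !mul0mx oppr0 add0r mul1mx !mul1mx.
have dz t : T < t -> is_derive t 1 z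
    (- (M2 *m z (t - tau)) - M2 *m (C1 *m w (t - tau))).
  move=> Tt; apply: (is_derive_eq (zd _ _ (du _ Tt))).
  rewrite C1x !(mulmxDr, mulmxN, mulmxA) W2M2 W2B2 !mul0mx subr0.
  by rewrite M2u opprD addrC.
have dv t : T < t -> is_derive t 1 v (- (M3 *m (C2 *m (C1 *m x (t - sigma))))).
  move=> Tt; apply: (is_derive_eq (vd _ _ (du _ Tt))).
  rewrite !(mulmxDr, mulmxN, mulmxA) P2M2 P2B2 !mul0mx oppr0 add0r.
  by rewrite mul1mx.
have drho t : T < t -> is_derive t 1 rho (- (M3 *m rho (t - sigma))
    - M3 *m (C2 *m (C1 *m w (t - sigma)) + C2 *m z (t - sigma))).
  move=> Tt; apply: (is_derive_eq (rhod _ _ (dv _ Tt))).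
  rewrite C1x mulmxDr C2u addrA mulmxN (mulmxA W3) W3M3.
  by rewrite [M3 *m (_ + v _)]mulmxDr M3v opprD [LHS]addrC.
have Tr r t : 0 <= r -> T + r < t -> T < t by lra.
have w2 : vsqint w.
  apply: (st1 dw); last by move=> t _; exact: P1w.
    by move=> t _; exists 0; exact: is_derive_cst.
  exact: vsqint0.
have z2 : vsqint z.
  (* The threshold moves by [tau] so that the delayed forcing is already differentiable. *)
  refine (st2 (T := T + tau) (f := fun t => - (M2 *m (C1 *m w (t - tau)))) _ _ _ _).
  - by move=> t /(Tr _ _ tau_ge0); exact: dz.
  - move=> t Tt; have Tt' : T < t - tau by lra.
    eexists; apply: is_deriveN; apply: der_mulmx; apply: der_mulmx.
    by apply: der_mx_shift; exact: dw.
  - by apply: vsqintN; apply: vsqintM; apply: vsqintM; exact: vsqint_shift.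
  - by move=> t _; exact: P2z.
have rho2 : vsqint rho.
  refine (st3 (T := T + sigma) (f := fun t =>
     - (M3 *m (C2 *m (C1 *m w (t - sigma)) + C2 *m z (t - sigma)))) _ _ _ _).
  - by move=> t /(Tr _ _ sigma_ge0); exact: drho.
  - move=> t Tt; have Tt' : T < t - sigma by lra.
    eexists; apply: is_deriveN; apply: der_mulmx; apply: is_deriveD.
      apply: der_mulmx; apply: der_mulmx.
      by apply: der_mx_shift; exact: dw.
    by apply: der_mulmx; apply: der_mx_shift; exact: dz.
  - apply: vsqintN; apply: vsqintM; apply: vsqintD.
      by apply: vsqintM; apply: vsqintM; exact: vsqint_shift.
    by apply: vsqintM; exact: vsqint_shift.
  - by move=> t _; exact: P3rho.
have w0 : w t @[t --> +oo] --> (0 : 'cV[R]_N1).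
  apply: (vsqint_cvg0 dw w2); apply: vsqintD; last exact: vsqint0.
  by apply: vsqintN; apply: vsqintM; exact: vsqint_shift.
have z0 : z t @[t --> +oo] --> (0 : 'cV[R]_N2).
  apply: (vsqint_cvg0 dz z2); apply: vsqintD; apply: vsqintN; apply: vsqintM.
    exact: vsqint_shift.
  by apply: vsqintM; exact: vsqint_shift.
have rho0 : rho t @[t --> +oo] --> (0 : 'cV[R]_N3).
  apply: (vsqint_cvg0 drho rho2); apply: vsqintD; apply: vsqintN; apply: vsqintM.
    exact: vsqint_shift.
  apply: vsqintD; last by apply: vsqintM; exact: vsqint_shift.
  by apply: vsqintM; apply: vsqintM; exact: vsqint_shift.
have H : w t + B1 *m (z t + B2 *m (rho t + B3 *m c)) @[t --> +oo] -->
    (0 + B1 *m (0 + B2 *m (0 + B3 *m c)) : 'cV[R]_N1).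
  apply: cvgD => //; apply: cvg_mulmx; apply: cvgD => //; apply: cvg_mulmx.
  by apply: cvgD => //; exact: cvg_cst.
rewrite !add0r in H; apply: cvg_trans H; apply: near_eq_cvg; near=> t.
have Tt : T < t by near: t; apply: nbhs_pinfty_gt; rewrite num_real.
by rewrite xE uE vE cv.
Unshelve. all: by end_near. Qed.

End ThreeLayers.

(** * The unstable scalar delay equation *)

Section DelayUnstable.
Variable R : realType.
Implicit Types (f g F q : R -> R) (t a b c d mu r x y : R).

(** Induction on the exceptional points: an interior one splits the interval, and continuity joins
    the two halves. *)
Lemma cst_off_finite f (s : seq R) a b : a <= b -> continuous f ->
  (forall t, a < t < b -> t \notin s -> is_derive t 1 f 0) -> f a = f b.
Proof.
move=> + cf; elim: s a b => [|c s IH] a b ab df.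
  have [||c _] := @MVT_segment _ f (fun=> 0) a b ab.
  - by move=> t /[!in_itv]/= tab; exact: df.
  - exact: continuous_subspaceT.
  by rewrite mul0r => /eqP; rewrite subr_eq0 eq_sym => /eqP.
have [/andP[ac cb]|ncab] := boolP (a < c < b).
  transitivity (f c); apply: IH; rewrite ?(ltW ac) ?(ltW cb)//.
  - move=> t /andP[at_ tc] ts; apply: df; first by rewrite at_ (lt_trans tc).
    by rewrite inE negb_or ts lt_eqF.
  - move=> t /andP[ct tb] ts; apply: df; first by rewrite tb (lt_trans ac).
    by rewrite inE negb_or ts gt_eqF.
apply: IH => // t tab ts; apply: df => //.
by rewrite inE negb_or ts andbT; apply: contra ncab => /eqP <-.
Qed.

Lemma continuous_max0 : continuous (fun t : R => Num.max t 0).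
Proof. by move=> t; apply: continuous_max; [exact: cvg_id|exact: cvg_cst]. Qed.

(** Freezing the argument at 0 removes the jump that zero history creates there. *)
Lemma within_ray_comp_max (T : topologicalType) (f : R -> T) :
  {within `[0, +oo[, continuous f} -> continuous (fun t => f (Num.max t 0)).
Proof.
move=> /subspace_continuousP cf t.
have A0 : `[0, +oo[%classic (Num.max t 0) by rewrite /= in_itv/= le_max lexx orbT.
apply: (cvg_comp _ _ _ (cf _ A0)) => U; rewrite !nbhs_simpl /within/= => HU.
have H1 : nbhs t [set u | `[0, +oo[%classic (Num.max u 0) -> U (Num.max u 0)].
  exact: (@continuous_max0 t _ HU).
change (nbhs t [set u | U (Num.max u 0)]); apply: filterS H1 => u /= H; apply: H.
by rewrite in_itv/= le_max lexx orbT.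
Qed.

(* A root [x + i y] of [z + mu exp (- z r)] in the closed right half-plane.
   Writing [y r = phi + pi / 2], the ratio of the two equations gives
   [x r = (phi + pi / 2) tan phi], and the intermediate value theorem solves the
   remaining one for [phi]. *)
Lemma unstable_root mu r : 0 < mu -> 0 < r -> pi / 2 <= mu * r ->
  exists x y : R, [/\ 0 <= x, 0 <= y, x = - mu * expR (- (x * r)) * cos (y * r)
    & y = mu * expR (- (x * r)) * sin (y * r)].
Proof.
move=> mu0 r0 mur; set m := mu * r in mur.
have pi0 := pi_gt0 R.
have m0 : 0 < m by rewrite mulr_gt0.
pose v := pi / 2 / m.
have v0 : 0 < v by rewrite divr_gt0// divr_gt0.
have v1 : v <= 1 by rewrite ler_pdivrMr// mul1r.
have v11 : -1 <= v <= 1 by rewrite v1 andbT; lra.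
(* Here [m * cos p1 = pi / 2], whence [F p1 >= 0], while [F 0 = pi / 2 - m <= 0]. *)
pose p1 := acos v.
have cp1 : cos p1 = v by rewrite /p1 acosK// in_itv.
have p10 : 0 <= p1 by exact: acos_ge0.
have p1pi : p1 < pi / 2.
  rewrite -(@ltr_cos R) ?cos_pihalf ?cp1// in_itv/=; last by lra.
  by rewrite p10 acos_lepi.
have cpos (p : R) : 0 <= p <= p1 -> 0 < cos p.
  by move=> /andP[H1 H2]; apply: cos_gt0_pihalf; lra.
pose X (p : R) := (p + pi / 2) * tan p.
pose F (p : R) := (p + pi / 2) * expR (X p) - m * cos p.
have X0 p : 0 <= p <= p1 -> 0 <= X p.
  move=> H; rewrite /X mulr_ge0//; first by move/andP: H => [? _]; lra.
  rewrite /tan divr_ge0 ?(ltW (cpos _ H))// sin_ge0_pi//.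
  by move/andP: H => [? ?]; lra.
have [|||p] := @IVT _ F 0 p1 0 => //.
- apply: derivable_within_continuous => p /[!in_itv]/= H.
  have dt := is_derive_tan (lt0r_neq0 (cpos _ H)).
  have [d dX] : exists d : R, is_derive p 1 X d by eexists; rewrite /X; der.
  have dE := der_comp (is_derive_expR (X p)) dX.
  have dc := is_derive_cos p.
  have [e dF] : exists e : R, is_derive p 1 F e by eexists; rewrite /F; der.
  by have [] := dF.
- have F0 : F 0 <= 0.
    rewrite /F /X /tan sin0 mul0r mulr0 expR0 cos0 add0r !mulr1; lra.
  have F1 : 0 <= F p1.
    have mv : m * v = pi / 2 by rewrite /v mulrC divfK ?gt_eqF.
    rewrite /F cp1 mv.
    have p1I : 0 <= p1 <= p1 by rewrite p10 lexx.
    have : 1 <= expR (X p1) by rewrite -expR0 ler_expR X0.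
    nra.
  by rewrite ge_min F0/= le_max F1 orbT.
rewrite in_itv/= => pI Fp.
exists (X p / r), ((p + pi / 2) / r).
have rn0 : r != 0 by rewrite gt_eqF.
rewrite !divfK// cosDpihalf sinDpihalf.
have cp := cpos _ pI.
have Fp' : p + pi / 2 = m * expR (- X p) * cos p.
  have /eqP := Fp; rewrite subr_eq0 => /eqP H.
  by rewrite mulrAC -H -mulrA expRN mulfV ?mulr1// gt_eqF ?expR_gt0.
split.
- by rewrite divr_ge0 ?X0// ltW.
- by move/andP: pI => [? _]; rewrite divr_ge0//; lra.
- rewrite {1}/X {1}Fp' /m /tan; field; rewrite rn0 gt_eqF//.
- by rewrite Fp' /m; field.
Qed.

Lemma fundamental_not_cvg0 mu r q (s : seq R) : 0 < mu -> 0 < r ->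
  pi / 2 <= mu * r -> (forall t, t < 0 -> q t = 0) -> q 0 != 0 ->
  {within `[0, +oo[, continuous q} ->
  (forall t, 0 < t -> t \notin s -> is_derive t 1 q (- mu * q (t - r))) ->
  ~ (q t @[t --> +oo] --> (0 : R)).
Proof.
move=> mu0 r0 mur q_lt0 q0 /within_ray_comp_max cq dq q_cvg.
have [x [y [x0 y0 xE yE]]] := unstable_root mu0 r0 mur.
pose Ex (t : R) : R := expR (- x * t).
have dEx t : is_derive t 1 Ex (- x * Ex t).
  have dl : is_derive t 1 (fun t => - x * t) (- x) by dereq; ring.
  by apply: der_eq (der_comp (is_derive_expR _) dl) _; rewrite mulrC.
(* With [s = x + i y], [E] and [b] are the real parts of [exp (- s t)] and [s exp (- s t)]; the
   characteristic equation becomes [bE]. *)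
pose E (t : R) : R := Ex t * cos (y * t); pose S (t : R) : R := Ex t * sin (y * t).
pose b (t : R) : R := x * E t + y * S t.
have dE t : is_derive t 1 E (- b t).
  by have := dEx t => ?; rewrite /E; dereq; rewrite /b /E /S; ring.
have bE t : b (t - r) = - mu * E t.
  have ee : expR (x * r) * expR (- (x * r)) = 1 by rewrite -expRD subrr expR0.
  have exr : Ex (t - r) = Ex t * expR (x * r).
    have e1 : - x * (t - r) = - x * t + x * r :> R by ring.
    by rewrite /Ex e1 expRD.
  rewrite /b /E /S exr mulrBr cosB sinB.
  have cs := cos2Dsin2 (y * r).
  set A := expR (x * r) in ee *; set A' := expR (- (x * r)) in ee *.
  set c := cos (y * r) in cs *; set d := sin (y * r) in cs *.
  set ct := cos (y * t); set st := sin (y * t).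
  rewrite [X in X * _ + _]xE [X in _ + X * _]yE -/A' -/c -/d.
  transitivity (- mu * (Ex t * ct) * (A * A') * (c ^+ 2 + d ^+ 2)); first by ring.
  by rewrite ee cs !mulr1.
pose qm t := q (Num.max t 0).
have qmE t : 0 <= t -> qm t = q t by move=> t0; rewrite /qm max_l.
have cb : continuous b.
  move=> t; have H := dEx t.
  have [d db] : exists d : R, is_derive t 1 b d by eexists; rewrite /b /E /S; der.
  exact: der_continuous db.
have [F dF] : exists F : R -> R, forall t, -1 < t -> is_derive t 1 F (b t * qm t).
  apply: (@antiderivative _ _ (-2)); first by lra.
  by move=> t _; apply: cvgM; [exact: cb|exact: cq].
(* The integral of [b * q] from 0, continued by 0 to negative times in accordance with the zero
   history of [q]. *)
pose K t := F (Num.max t 0) - F 0.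
have K0 t : t <= 0 -> K t = 0 by move=> t0; rewrite /K max_r// subrr.
have cK : continuous K.
  move=> t; apply: cvgB; last exact: cvg_cst.
  apply: (cvg_comp _ F (@continuous_max0 t)).
  apply: der_continuous; apply: dF; apply: (@lt_le_trans _ _ 0); first lra.
  by rewrite le_max lexx orbT.
have dK t : t != 0 -> is_derive t 1 K (b t * q t).
  rewrite neq_lt => /orP[t0|t0].
    rewrite q_lt0// mulr0; refine (der_near _ (der_cst t 0)).
    by near=> u; rewrite K0// ltW//; near: u; exact: lt_nbhsl.
  rewrite -qmE ?ltW//; apply: (@der_near _ (fun t => F t - F 0)).
    by near=> u; rewrite /K max_l// ltW//; near: u; exact: lt_nbhsr.
  have := dF t (lt_trans (ltrN10 _) t0) => ?; dereq; ring.
pose H t := E t * qm t + K t - K (t - r).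
have cH : continuous H.
  move=> t; apply: cvgB; last first.
    apply: (cvg_comp _ K (G := nbhs (t - r))); last exact: cK.
    by apply: cvgB; [exact: cvg_id|exact: cvg_cst].
  apply: cvgD; last exact: cK.
  by apply: cvgM; [exact: (der_continuous (dE t))|exact: cq].
have H0 t : 0 <= t -> H t = q 0.
  move=> t0; transitivity (H 0); last first.
    rewrite /H !K0 ?sub0r ?oppr_le0 ?(ltW r0)// qmE// /E /Ex mulr0 expR0 mulr0 cos0.
    ring.
  (* The time [r] is exceptional too, since [K] may have a corner at 0. *)
  apply/esym; apply: (@cst_off_finite _ (r :: s)) => // u /andP[u0 ut].
  rewrite inE negb_or => /andP[ur us].
  apply: (@der_near _ (fun t => E t * q t + K t - K (t - r))).
    by near=> w; rewrite /H qmE// ltW//; near: w; exact: lt_nbhsr.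
  have h1 := dE u; have h2 := dq _ u0 us; have h3 := dK u (lt0r_neq0 u0).
  have h4 : is_derive (u - r) 1 K (b (u - r) * q (u - r)).
    by apply: dK; rewrite subr_eq0.
  dereq; rewrite bE; ring.
have Ex1 t : 0 <= t -> 0 <= Ex t <= 1.
  move=> t0; rewrite expR_ge0/= -expR0 ler_expR mulNr oppr_le0 mulr_ge0//.
have En t : 0 <= t -> `|E t| <= 1.
  move=> /Ex1/andP[e0 e1]; rewrite normrM (ger0_norm e0).
  by rewrite -[leRHS]mulr1 ler_pM// cos_max.
have bn t : 0 <= t -> `|b t| <= x + y.
  move=> t0; apply: le_trans (ler_normD _ _) _; rewrite !normrM.
  rewrite (ger0_norm x0) (ger0_norm y0).
  have /andP[e0 e1] := Ex1 _ t0; rewrite (ger0_norm e0).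
  have /= := cos_max (y * t); have /= := sin_max (y * t).
  set ac := `|cos _|; set as_ := `|sin _| => h1 h2.
  have h3 : 0 <= ac by exact: normr_ge0.
  have h4 : 0 <= as_ by exact: normr_ge0.
  by apply: lerD; rewrite ler_piMr// mulr_ile1.
have xy0 : 0 <= x + y by rewrite addr_ge0.
(* If [|q| < e] on a window of length [r], then [|H|] is below [e * (1 + (x + y) * r)], which is
   half of [|q 0|]. *)
pose e := `|q 0| / (2 * (1 + (x + y) * r)).
have D0 : 0 < 1 + (x + y) * r by rewrite ltr_pwDl// mulr_ge0// ltW.
have e0 : 0 < e by rewrite divr_gt0 ?normr_gt0// mulr_gt0.
have /cvgrPdist_lt/(_ _ e0)[A [_ HA]] := q_cvg.
have {}HA t : A < t -> `|q t| < e by move=> /HA /=; rewrite sub0r normrN.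
pose t := Num.max A 0 + r + 1.
have tP u : t - r <= u -> A < u /\ 0 < u.
  rewrite /t => h; have : Num.max A 0 < u by lra.
  by rewrite gt_max => /andP[].
have [At t0] := tP t (ltac:(lra)).
have := H0 t (ltW t0).
have [|||w wI KE] := @MVT_segment _ K (fun t => b t * q t) (t - r) t; first by lra.
- move=> u /[!in_itv]/= /andP[u1 u2]; apply: dK.
  by have [_] := tP u (ltW u1); exact: lt0r_neq0.
- exact: continuous_subspaceT.
rewrite /H qmE ?(ltW t0)// -addrA KE => h.
rewrite in_itv/= in wI; move/andP: wI => [w1 w2].
have [Aw w0] := tP w w1.
have : `|q 0| < e * (1 + (x + y) * r).
  have h1 : `|E t * q t| < e.
    by rewrite normrM (le_lt_trans _ (HA _ At))// ler_piMl// En// ltW.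
  have h2 : `|b w * q w * (t - (t - r))| <= (x + y) * e * r.
    have -> : t - (t - r) = r by rewrite opprB addrC subrK.
    rewrite normrM (gtr0_norm r0) ler_pM2r// normrM ler_pM//; first exact/bn/ltW.
    exact/ltW/HA.
  rewrite -h (le_lt_trans (ler_normD _ _))//; lra.
rewrite /e; have -> : `|q 0| / (2 * (1 + (x + y) * r)) * (1 + (x + y) * r) = `|q 0| / 2.
  by field; rewrite gt_eqF.
by have := normr_ge0 (q 0); lra.
Unshelve. all: by end_near. Qed.

End DelayUnstable.

(** * Existence of solutions *)

Section DelayExistence.
Variable R : realType.
Implicit Types t : R.

(** The iterated integrals of the unit step. The step takes the value 1 at 0, so the solution
    assumes [x0] there; the positive part in higher degrees makes continuity at 0 immediate. *)
Definition trunc_pow n t : R :=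
  if n is k.+1 then t ^+ k * Num.max t 0 / (n`!)%:R else (0 <= t)%R%:R.

Lemma trunc_pow_lt0 n t : t < 0 -> trunc_pow n t = 0.
Proof.
move=> t0; case: n => [|n] /=; first by rewrite leNgt t0.
by rewrite max_r ?ltW// mulr0 mul0r.
Qed.

Lemma trunc_pow_gt0 n t : 0 < t -> trunc_pow n t = t ^+ n / (n`!)%:R.
Proof.
move=> t0; case: n => [|n] /=; first by rewrite (ltW t0) expr0 divr1.
by rewrite max_l ?ltW// -exprSr.
Qed.

Lemma continuous_trunc_pow n : continuous (trunc_pow n.+1).
Proof.
move=> t; apply: cvgM; last exact: cvg_cst.
by apply: cvgM; [exact: exprn_continuous|exact: continuous_max0].
Qed.

Lemma der_exprn n t : is_derive t 1 (fun x : R => x ^+ n.+1) (n.+1%:R * t ^+ n).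
Proof.
elim: n => [|n IH].
  by rewrite expr0 mulr1; under eq_fun do rewrite expr1; exact: der_id.
under eq_fun do rewrite exprS.
by dereq; rewrite -(natr1 n.+1) exprS; ring.
Qed.

(** The only excluded case is the corner at 0 of the truncated power of degree 1 and its jump
    derivative. *)
Lemma der_trunc_pow n t : (0 < n)%N \/ t != 0 ->
  is_derive t 1 (trunc_pow n.+1) (trunc_pow n t).
Proof.
have [t0|t0|->] := ltgtP t 0.
- move=> _; rewrite trunc_pow_lt0//; refine (der_near _ (der_cst t 0)).
  by near=> u; rewrite trunc_pow_lt0//; near: u; exact: lt_nbhsl.
- move=> _; rewrite trunc_pow_gt0//.
  apply: (@der_near _ (fun t => t ^+ n.+1 / (n.+1`!)%:R)).
    by near=> u; rewrite trunc_pow_gt0//; near: u; exact: lt_nbhsr.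
  have dX := der_exprn n t.
  dereq; rewrite factS natrM; field.
  by rewrite nat1r !pnatr_eq0 -!lt0n fact_gt0.
- case=> [|/negP/(_ isT)[]]; case: n => // n _.
  apply/is_derive1_caratheodory.
  exists (fun z => z ^+ n * Num.max z 0 / (n.+2`!)%:R); split.
  + by move=> z; rewrite /= maxxx !(mulr0, mul0r) !subr0 exprSr; ring.
  + apply: cvgM; last exact: cvg_cst.
    by apply: cvgM; [exact: exprn_continuous|exact: continuous_max0].
  + by rewrite /= maxxx !(mulr0, mul0r).
Unshelve. all: by end_near. Qed.

Variables (n : nat) (A B : 'M[R]_n) (tau sigma : R) (x0 : 'cV[R]_n).
Hypotheses (tau_gt0 : 0 < tau) (sigma_gt0 : 0 < sigma).
Implicit Types l : seq ('cV[R]_n * R).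

(* The solution is a locally finite sum of delayed truncated powers: [l] lists the pairs
   (coefficient, delay) of one degree, and integrating the equation once maps the list of
   degree [k] to that of degree [k.+1]. *)
Definition pow_sum k l t : 'cV[R]_n := \sum_(p <- l) trunc_pow k (t - p.2) *: p.1.

Definition delay_step l :=
  [seq (- (A *m p.1), p.2 + tau) | p <- l] ++
  [seq (- (B *m p.1), p.2 + sigma) | p <- l].

Lemma pow_sum_step k l t : pow_sum k (delay_step l) t =
  - (A *m pow_sum k l (t - tau)) - B *m pow_sum k l (t - sigma).
Proof.
rewrite /pow_sum /delay_step big_cat !big_map !mulmx_sumr -!sumrN.
congr (_ + _); apply: eq_bigr => p _ /=.
  by rewrite -scalemxAr -scalerN opprD addrA addrAC.
by rewrite -scalemxAr -scalerN opprD addrA addrAC.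
Qed.

Lemma der_pow_sum k l t : {in l, forall p, (0 < k)%N \/ t != p.2} ->
  is_derive t 1 (pow_sum k.+1 l) (pow_sum k l t).
Proof.
move=> H; apply/der_mxP => i j; rewrite /pow_sum.
elim: l H => [|p l IH] H.
  rewrite big_nil mxE; under eq_fun do rewrite big_nil mxE; exact: der_cst.
rewrite big_cons mxE; under eq_fun do rewrite big_cons mxE.
apply: derD; last by apply: IH => q ql; apply: H; rewrite inE ql orbT.
rewrite mxE; under eq_fun do rewrite mxE.
have H' : is_derive (t - p.2) 1 (trunc_pow k.+1) (trunc_pow k (t - p.2)).
  by apply: der_trunc_pow; have := H p (mem_head _ _); rewrite subr_eq0.
by dereq; ring.
Qed.

Definition delay_terms k := iter k delay_step [:: (x0, 0)].
Definition delay_min := Num.min tau sigma.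

Lemma delay_min_gt0 : 0 < delay_min.
Proof. by rewrite lt_min tau_gt0. Qed.

(** Each integration adds at least one delay, so at any given time only finitely many degrees
    contribute. *)
Lemma delay_terms_ge k p : p \in delay_terms k -> k%:R * delay_min <= p.2.
Proof.
elim: k p => [|k IH] p; first by rewrite inE => /eqP ->; rewrite mul0r.
rewrite /= mem_cat => /orP[] /mapP[q /IH kq ->] /=.
  by rewrite -natr1 mulrDl mul1r lerD// ge_min lexx.
by rewrite -natr1 mulrDl mul1r lerD// ge_min lexx orbT.
Qed.

Definition delay_iter k := pow_sum k (delay_terms k).

Lemma delay_iter_eq0 k t : t < k%:R * delay_min -> delay_iter k t = 0.
Proof.
move=> tk; rewrite /delay_iter /pow_sum big_seq big1// => p /delay_terms_ge kp.
by rewrite trunc_pow_lt0 ?scale0r// subr_lt0 (lt_le_trans tk).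
Qed.

Lemma der_delay_iter k t : (0 < k)%N \/ t \notin [:: tau; sigma] ->
  is_derive t 1 (delay_iter k.+1)
    (- (A *m delay_iter k (t - tau)) - B *m delay_iter k (t - sigma)).
Proof.
move=> H; rewrite -pow_sum_step; apply: der_pow_sum => p pl.
case: H => [|tn]; first by left.
case: k pl => [|k]; last by left.
rewrite !inE /= => /orP[] /eqP -> /=; right; rewrite add0r.
  by apply: contra tn => /eqP ->; rewrite mem_head.
by apply: contra tn => /eqP ->; rewrite !inE eqxx orbT.
Qed.

Definition delay_partial m t : 'cV[R]_n := \sum_(0 <= k < m) delay_iter k t.

Lemma delay_partial_stable m m' t : t < m%:R * delay_min -> (m <= m')%N ->
  delay_partial m' t = delay_partial m t.
Proof.
move=> tm mm'; rewrite /delay_partial (big_cat_nat (n := m))//=.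
rewrite [X in _ + X]big_nat_cond [X in _ + X]big1 ?addr0// => k /andP[/andP[mk _] _].
apply: delay_iter_eq0; apply: lt_le_trans tm _.
by rewrite ler_pM2r ?delay_min_gt0// ler_nat.
Qed.

(** The cut-off depends on [t] and exceeds [t / delay_min], so every omitted degree vanishes at
    [t]. *)
Definition delay_sol t := delay_partial (Num.bound `|t / delay_min|) t.

Lemma delay_solE m t : t < m%:R * delay_min -> delay_sol t = delay_partial m t.
Proof.
move=> tm; have d0 := delay_min_gt0.
have tb : t < (Num.bound `|t / delay_min|)%:R * delay_min.
  rewrite -ltr_pdivrMr//; exact: le_lt_trans (ler_norm _) (archi_boundP (normr_ge0 _)).
rewrite /delay_sol; have [le|/ltnW le] := leqP m (Num.bound `|t / delay_min|).
  exact: delay_partial_stable.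
by rewrite (delay_partial_stable tb le).
Qed.

Lemma exists_bound t : exists m, t < m%:R * delay_min.
Proof.
exists (Num.bound `|t / delay_min|).
rewrite -ltr_pdivrMr ?delay_min_gt0//.
exact: le_lt_trans (ler_norm _) (archi_boundP (normr_ge0 _)).
Qed.

Lemma delay_exists : exists u : R -> 'cV[R]_n,
  [/\ forall t, t < 0 -> u t = 0, u 0 = x0, {within `[0, +oo[, continuous u} &
   forall t, 0 < t -> t \notin [:: tau; sigma] ->
     is_derive t 1 u (- (A *m u (t - tau)) - B *m u (t - sigma))].
Proof.
have d0 := delay_min_gt0.
have it0 t : 0 <= t -> delay_iter 0 t = x0.
  by move=> t0; rewrite /delay_iter /pow_sum big_seq1 subr0 /= t0 scale1r.
exists delay_sol; split.
- by move=> t t0; rewrite (delay_solE (m := 0)) ?mul0r// /delay_partial big_nil.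
- by rewrite (delay_solE (m := 1)) ?mul1r// /delay_partial big_nat1 it0.
- apply/subspace_continuousP => t; rewrite /= in_itv/= andbT => t0.
  have [m tm] := exists_bound t.
  have tm1 : t < m.+1%:R * delay_min.
    by apply: lt_le_trans tm _; rewrite ler_pM2r// ler_nat.
  (* Replacing the step of degree 0 by the constant [x0] gives a function continuous across 0 that
     agrees with the solution at nonnegative times. *)
  pose v t := x0 + \sum_(0 <= k < m) delay_iter k.+1 t.
  have uv u : 0 <= u -> u < m.+1%:R * delay_min -> delay_sol u = v u.
    by move=> u0 um; rewrite (delay_solE um) /delay_partial big_nat_recl// it0.
  have cv : v x @[x --> t] --> v t.
    apply: cvgD; first exact: cvg_cst.
    apply: cvg_big => [|k _]; first exact: add_continuous.
    rewrite /delay_iter /pow_sum.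
    apply: cvg_big => [|p _]; first exact: add_continuous.
    apply: cvgZl.
    apply: (cvg_comp _ (trunc_pow k.+1)); last exact: continuous_trunc_pow.
    by apply: cvgB; [exact: cvg_id|exact: cvg_cst].
  rewrite /from_subspace uv//.
  apply: cvg_trans (cvg_within_filter `[0, +oo[%classic cv).
  apply: near_eq_cvg; rewrite near_withinE; near=> u => /=.
  rewrite in_itv/= andbT => u0; rewrite uv//.
  by near: u; exact: lt_nbhsl.
- move=> t t0 tn; have [m tm] := exists_bound t.
  have dlt r : delay_min <= r -> t - r < m%:R * delay_min - delay_min.
    by move=> ?; lra.
  have m0 : (0 < m)%N by case: m tm {dlt} => //; rewrite mul0r => /(lt_trans t0); rewrite ltxx.
  case: m m0 tm dlt => // m _ tm dlt.
  (* Going back by one delay saves one degree, which matches the degree lost by differentiation. *)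
  have shiftE r : delay_min <= r -> delay_sol (t - r) = delay_partial m (t - r).
    by move=> /dlt; rewrite -natr1 mulrDl mul1r addrK => /delay_solE.
  rewrite !shiftE ?ge_min ?lexx ?orbT//.
  pose v t := x0 + \sum_(0 <= k < m) delay_iter k.+1 t.
  have near_v : \forall u \near t, v u = delay_sol u.
    near=> u; rewrite (delay_solE (m := m.+1)); last by near: u; exact: lt_nbhsl.
    rewrite /delay_partial big_nat_recl// it0// ltW//.
    by near: u; exact: lt_nbhsr.
  apply: (near_eq_is_derive near_v).
  have -> : - (A *m delay_partial m (t - tau)) - B *m delay_partial m (t - sigma) =
    0 + \sum_(0 <= k < m) (- (A *m delay_iter k (t - tau)) - B *m delay_iter k (t - sigma)).
    by rewrite add0r /delay_partial !mulmx_sumr -!sumrN -big_split.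
  have : is_derive t 1 (fun x => \sum_(0 <= k < m) delay_iter k.+1 x)
    (\sum_(0 <= k < m) (- (A *m delay_iter k (t - tau)) - B *m delay_iter k (t - sigma))).
    elim: m {tm dlt shiftE v near_v} => [|m IH].
      by rewrite big_nil; under eq_fun do rewrite big_nil; exact: is_derive_cst.
    rewrite big_nat_recr//=; under eq_fun do rewrite big_nat_recr//=.
    by apply: is_deriveD => //; apply: der_delay_iter; right.
  exact: (is_deriveD (is_derive_cst x0 t 1)).
Unshelve. all: by end_near. Qed.

End DelayExistence.

(** * Reduction of the hierarchical system *)

Section Assembly.
Variable R : realType.
Implicit Types t : R.

Lemma within_mulmx m n p (D : set R) (A : 'M[R]_(m, n)) (z : R -> 'M[R]_(n, p)) :
  {within D, continuous z} -> {within D, continuous (fun t => A *m z t)}.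
Proof.
move=> /subspace_continuousP cz; apply/subspace_continuousP => t Dt.
exact: cvg_mulmx (cz _ Dt).
Qed.

(** Since [mu != 0], [l] annihilates [B], hence both the forcing and the alleged limit. What remains
    is a scalar delay equation whose initial value [l *m l^T] is nonzero. *)
Lemma unstable_layer n m (M : 'M[R]_n) (B : 'M[R]_(n, m)) (l : 'rV[R]_n) (mu r : R)
    (u : R -> 'cV[R]_n) (w : R -> 'cV[R]_m) (s : seq R) c :
  M *m B = 0 -> l *m M = mu *: l -> l != 0 -> 0 < mu -> 0 < r ->
  pi / 2 <= mu * r ->
  (forall t, t < 0 -> u t = 0) -> u 0 = l^T ->
  {within `[0, +oo[, continuous u} ->
  (forall t, 0 < t -> t \notin s ->
     is_derive t 1 u (- (M *m u (t - r)) - B *m w t)) ->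
  ~ (u t @[t --> +oo] --> B *m c).
Proof.
move=> MB lM l0 mu0 r0 mur u_lt0 u0 cu du ucvg.
have lB : l *m B = 0.
  have : mu *: (l *m B) == 0 by rewrite scalemxAl -lM -mulmxA MB mulmx0.
  by rewrite scaler_eq0 gt_eqF// => /eqP.
have ll : (l *m l^T) 0 0 != 0.
  apply: contra l0; rewrite mxE; under eq_bigr => i _ do rewrite mxE -expr2.
  rewrite psumr_eq0 => [/allP H|i _]; last exact: sqr_ge0.
  apply/eqP/rowP => i; have /implyP/(_ isT) := H i (mem_index_enum _).
  by rewrite sqrf_eq0 mxE => /eqP.
apply: (@fundamental_not_cvg0 _ mu r (fun t => (l *m u t) 0 0) s) => //.
- by move=> t t0; rewrite u_lt0// mulmx0 mxE.
- by rewrite u0.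
- have /subspace_continuousP H := within_mulmx (A := l) cu.
  by apply/subspace_continuousP => t Dt; move: (H t Dt) => /cvg_mxP; exact.
- move=> t t0 ts; have /der_mxP/(_ 0 0) H := der_mulmx l (du t t0 ts).
  apply: (der_eq H); rewrite mulmxBr mulmxN !mulmxA lM lB mul0mx subr0.
  by rewrite -scalemxAl !mxE mulNr.
- have : l *m u t @[t --> +oo] --> l *m (B *m c) by exact: cvg_mulmx.
  by rewrite mulmxA lB mul0mx => /cvg_mxP/(_ 0 0); rewrite mxE.
Qed.

(** The left eigenvector [l *m C] is nonzero because [B] recovers [l] from it. *)
Lemma eigenvalue_conj n m (M : 'M[R]_m) (B : 'M[R]_(n, m)) (C : 'M[R]_(m, n)) mu :
  C *m B = 1%:M -> eigenvalue M mu -> eigenvalue (B *m M *m C) mu.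
Proof.
move=> CB /eigenvalueP[l lM l0]; apply/eigenvalueP; exists (l *m C).
  by rewrite !mulmxA -(mulmxA l) CB mulmx1 lM -scalemxAl.
by apply: contra l0 => /eqP lC; rewrite -(mulmx1 l) -CB mulmxA lC mul0mx.
Qed.

(** The converse away from 0: if [v *m B] vanished, so would [mu *: v]. *)
Lemma eigenvector_conj n m (M : 'M[R]_m) (B : 'M[R]_(n, m)) (C : 'M[R]_(m, n)) mu :
  C *m B = 1%:M -> mu != 0 -> eigenvalue (B *m M *m C) mu ->
  exists2 l : 'rV[R]_m, l *m M = mu *: l & l != 0.
Proof.
move=> CB mu0 /eigenvalueP[v vE v0]; exists (v *m B).
  by rewrite scalemxAl -vE !mulmxA -(mulmxA _ C) CB mulmx1.
apply: contra v0 => /eqP vB; move: vE; rewrite !mulmxA vB !mul0mx => /esym/eqP.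
by rewrite scaler_eq0 (negbTE mu0).
Qed.

Lemma group_CB n m (g : 'I_n -> 'I_m) (C : 'M[R]_(m, n)) :
  group_C g C -> C *m group_B R g = 1%:M.
Proof.
move=> [Cg [_ C1]]; apply/matrixP => p q; rewrite !mxE.
have [->|pq] := eqVneq p q.
  rewrite -[RHS](C1 q); apply: eq_bigr => i _; rewrite mxE.
  by have [_|/Cg ->] := eqVneq (g i) q; rewrite ?mulr1 ?mul0r.
apply: big1 => i _; rewrite mxE; have [giq|] := eqVneq (g i) q; last by rewrite mulr0.
by rewrite Cg ?mul0r// giq eq_sym.
Qed.

Lemma group_B_mul n m (g : 'I_n -> 'I_m) (v : 'cV[R]_m) i :
  (group_B R g *m v) i 0 = v (g i) 0.
Proof.
rewrite mxE (bigD1 (g i))//= mxE eqxx mul1r big1 ?addr0// => p pi.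
by rewrite mxE eq_sym (negbTE pi) mul0r.
Qed.

Lemma sum_agg_weights n m (g : 'I_n -> 'I_m) (a : 'I_n -> R) :
  \sum_p agg_weights g a p = \sum_i a i.
Proof. by rewrite [RHS](partition_big g xpredT). Qed.

Lemma sum_group_avg n m (g : 'I_n -> 'I_m) (a : 'I_n -> R) (v : 'cV[R]_n) :
  (forall p, 0 < agg_weights g a p) ->
  \sum_p agg_weights g a p * (group_avg g a *m v) p 0 = \sum_i a i * v i 0.
Proof.
move=> a0; rewrite [RHS](partition_big g xpredT)//=; apply: eq_bigr => p _.
rewrite /group_avg -!mulmxA mul_diag_mx !mxE mulVKf ?gt_eqF// [RHS]big_mkcond.
apply: eq_bigr => i _; rewrite mul_diag_mx !mxE.
by case: (g i == p); rewrite ?mul1r ?mul0r.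
Qed.

Lemma exists_above (s : seq R) : exists2 T, 0 <= T & forall t, T < t -> t \notin s.
Proof.
elim: s => [|x s [T T0 HT]]; first by exists 0.
exists (Num.max x T) => [|t]; first by rewrite le_max T0 orbT.
by rewrite gt_max inE negb_or => /andP[xt /HT ->]; rewrite gt_eqF.
Qed.

Section System.
Variables (N1 N2 N3 : nat).
Variables (g1 : 'I_N1 -> 'I_N2) (g2 : 'I_N2 -> 'I_N3).
Variables (adj1 : rel 'I_N1) (adj2 : rel 'I_N2) (adj3 : rel 'I_N3).
Variables (a : 'I_N1 -> R) (C1 : 'M[R]_(N2, N1)) (C2 : 'M[R]_(N3, N2)).
Variables (tau2 tau3 : R).
Hypotheses (tau2_ge0 : 0 <= tau2) (tau3_ge0 : 0 <= tau3).
Let M1 := Kmat a *m laplacian R adj1.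
Let M2 := Kmat (a2 g1 a) *m laplacian R adj2.
Let M3 := Kmat (a3 g1 g2 a) *m laplacian R adj3.
Let field := hier_field M1 M2 M3 (group_B R g1) (group_B R g2) C1 C2
  (2 * tau2) (2 * (tau2 + tau3)).
Let solution := hier_solution g1 g2 adj1 adj2 adj3 a C1 C2 tau2 tau3.

(* Measurements travel up and commands travel down, so the delays double. *)
Lemma hier_solution_delay x0 x1 x2 x3 y1 y2 : solution x0 x1 x2 x3 y1 y2 ->
  [/\ x1 0 = x0, {within `[0, +oo[, continuous x1} &
  exists s : seq R, forall t, 0 < t -> t \notin s -> is_derive t 1 x1 (field x1 t)].
Proof.
move=> [neg [x10 [cx [[s dx] [x2E [y1E [x3E y2E]]]]]]]; split => //; exists s.
move=> t t0 ts; apply: (is_derive_eq (dx t t0 ts)).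
(* The signal equations extend to negative times, where both sides are 0, so they can be substituted
   into each other at delayed arguments. *)
have x2E' (u : R) : x2 u = C1 *m x1 (u - tau2).
  have [u0|/x2E//] := ltP u 0; have [_ [-> _]] := neg u u0.
  have u1 : u - tau2 < 0 by rewrite subr_lt0 (lt_le_trans u0).
  by have [-> _] := neg _ u1; rewrite mulmx0.
have x3E' (u : R) : x3 u = C2 *m x2 (u - tau3).
  have [u0|/x3E//] := ltP u 0; have [_ [_ [-> _]]] := neg u u0.
  have u1 : u - tau3 < 0 by rewrite subr_lt0 (lt_le_trans u0).
  by have [_ [-> _]] := neg _ u1; rewrite mulmx0.
have y2E' (u : R) : y2 u = B2 R g2 *m (- (K3 g1 g2 a *m LD3 R adj3 *m x3 (u - tau3))).
  have [u0|/y2E//] := ltP u 0; have [_ [_ [_ [_ ->]]]] := neg u u0.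
  have u1 : u - tau3 < 0 by rewrite subr_lt0 (lt_le_trans u0).
  by have [_ [_ [-> _]]] := neg _ u1; rewrite mulmx0 oppr0 mulmx0.
rewrite y1E ?(ltW t0)// y2E' x3E' !x2E' /field /hier_field.
rewrite (_ : t - tau2 - tau2 = t - 2 * tau2); last by ring.
rewrite (_ : t - tau2 - tau3 - tau3 - tau2 = t - 2 * (tau2 + tau3)); last by ring.
by rewrite !(mulmxDr, mulmxN, mulmxA) addrA.
Qed.

Lemma delay_hier_solution x0 x1 (s : seq R) :
  (forall t, t < 0 -> x1 t = 0) -> x1 0 = x0 ->
  {within `[0, +oo[, continuous x1} ->
  (forall t, 0 < t -> t \notin s -> is_derive t 1 x1 (field x1 t)) ->
  exists x2 x3 y1 y2, solution x0 x1 x2 x3 y1 y2.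
Proof.
move=> neg x10 cx dx.
pose x2 t := C1 *m x1 (t - tau2); pose x3 t := C2 *m x2 (t - tau3).
pose y2 t := B2 R g2 *m (- (K3 g1 g2 a *m LD3 R adj3 *m x3 (t - tau3))).
pose y1 t := B1 R g1 *m (- (K2 g1 a *m LD2 R adj2 *m x2 (t - tau2)) + y2 (t - tau2)).
exists x2, x3, y1, y2.
have n2 t : t < 0 -> x2 t = 0 by move=> t0; rewrite /x2 neg ?mulmx0// subr_lt0 (lt_le_trans t0).
have n3 t : t < 0 -> x3 t = 0 by move=> t0; rewrite /x3 n2 ?mulmx0// subr_lt0 (lt_le_trans t0).
have m2 t : t < 0 -> y2 t = 0 by move=> t0; rewrite /y2 n3 ?(mulmx0, oppr0)// subr_lt0 (lt_le_trans t0).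
have m1 t : t < 0 -> y1 t = 0.
  by move=> t0; rewrite /y1 n2 ?m2 ?(mulmx0, oppr0, addr0)// subr_lt0 (lt_le_trans t0).
split; first by move=> t t0; rewrite neg// n2// n3// m1// m2.
do 2!split => //; split; last by [].
exists s => t t0 ts; apply: (is_derive_eq (dx t t0 ts)).
rewrite /y1 /y2 /x3 /x2 /field /hier_field.
rewrite (_ : t - tau2 - tau2 = t - 2 * tau2); last by ring.
rewrite (_ : t - tau2 - tau3 - tau3 - tau2 = t - 2 * (tau2 + tau3)); last by ring.
by rewrite !(mulmxDr, mulmxN, mulmxA) addrA.
Qed.

End System.
End Assembly.

(** * The consensus value as an iterated average *)

Section Consensus.
Variable R : realType.
Variables (N1 N2 N3 : nat) (g1 : 'I_N1 -> 'I_N2) (g2 : 'I_N2 -> 'I_N3).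
Variable a : 'I_N1 -> R.
Let g3 := fun _ : 'I_N3 => (ord0 : 'I_1).
Hypotheses (a2_gt0 : forall p, 0 < a2 g1 a p) (a3_gt0 : forall p, 0 < a3 g1 g2 a p)
  (a4_gt0 : forall p, 0 < agg_weights g3 (a3 g1 g2 a) p).

(** Every averaging stage preserves the weighted total, so the single top average times the sum of
    all weights is the weighted sum of [x0]; the [B] factors copy this number to every node. *)
Lemma consensusE (x0 : 'cV[R]_N1) :
  group_B R g1 *m (group_B R g2 *m (group_B R g3 *m
    (group_avg g3 (a3 g1 g2 a) *m (group_avg g2 (a2 g1 a) *m (group_avg g1 a *m x0)))))
  = consensus a x0.
Proof.
set v2 := group_avg g1 a *m x0; set v3 := group_avg g2 _ *m v2.
set c := group_avg g3 _ *m v3.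
have aE : agg_weights g3 (a3 g1 g2 a) 0 = \sum_i a i.
  by rewrite -(sum_agg_weights g1) -(sum_agg_weights g2) -(sum_agg_weights g3) big_ord1.
have cE : (\sum_i a i) * c 0 0 = \sum_i a i * x0 i 0.
  rewrite -(sum_group_avg (g := g1))// -(sum_group_avg (g := g2))//.
  by rewrite -(sum_group_avg (g := g3))// big_ord1 aE.
have S0 : \sum_i a i != 0 by rewrite -aE gt_eqF.
pose K := diag_mx (\row_i a i); pose one : 'cV[R]_N1 := const_mx 1.
have K1E : (one^T *m K *m one) 0 0 = \sum_i a i.
  by rewrite mxE; apply: eq_bigr => k _; rewrite mul_mx_diag !mxE mul1r mulr1.
have K2E i : (one *m one^T *m K *m x0) i 0 = \sum_i a i * x0 i 0.
  rewrite mxE; apply: eq_bigr => k _.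
  by rewrite mul_mx_diag !mxE big_ord1 !mxE !mul1r.
apply/matrixP => i j; rewrite ord1 !group_B_mul /consensus -/K -/one [RHS]mxE K1E K2E.
by apply: (mulfI S0); rewrite cE mulVKf.
Qed.

End Consensus.

(** The delay bounds are multiplied out, so that a maximum eigenvalue equal to 0 imposes no
    restriction instead of a division by 0. *)
Theorem theorem6 (R : realType) (N1 N2 N3 : nat)
  (hN1 : (0 < N1)%N) (hN2 : (0 < N2)%N) (hN3 : (0 < N3)%N)
  (g1 : 'I_N1 -> 'I_N2) (g2 : 'I_N2 -> 'I_N3)
  (hg1 : consecutive_grouping g1) (hg2 : consecutive_grouping g2)
  (adj1 : rel 'I_N1) (adj2 : rel 'I_N2) (adj3 : rel 'I_N3)
  (hadj1 : groupwise_connected_graph g1 adj1)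
  (hadj2 : groupwise_connected_graph g2 adj2)
  (hadj3 : groupwise_connected_graph (fun _ : 'I_N3 => (ord0 : 'I_1)) adj3)
  (a : 'I_N1 -> R) (ha : forall i, 0 < a i)
  (C1 : 'M[R]_(N2, N1)) (C2 : 'M[R]_(N3, N2))
  (hC1 : group_C g1 C1) (hC2 : group_C g2 C2)
  (tau2 tau3 : R) (htau2 : 0 <= tau2) (htau3 : 0 <= tau3)
  (lam2 lam3 : R)
  (hlam2 : is_max_eigenvalue (Lmat2 g1 adj2 a C1) lam2)
  (hlam3 : is_max_eigenvalue (Lmat3 g1 g2 adj3 a C1 C2) lam3) :
  (forall (x0 : 'cV[R]_N1) x1 x2 x3 y1 y2,
      hier_solution g1 g2 adj1 adj2 adj3 a C1 C2 tau2 tau3 x0 x1 x2 x3 y1 y2 ->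
      x1 t @[t --> +oo] --> consensus a x0)
  <->
  (4 * lam2 * tau2 < pi /\ 4 * lam3 * (tau2 + tau3) < pi).
Proof.
pose g3 := fun _ : 'I_N3 => (ord0 : 'I_1).
have g1s : forall p, exists i, g1 i = p by case: hg1.
have g2s : forall p, exists i, g2 i = p by case: hg2.
have g3s : forall p, exists i, g3 i = p.
  by move=> p; exists (Ordinal hN3); rewrite [RHS]ord1; exact: val_inj.
have a2_gt0 := agg_weights_gt0 g1s ha.
have a3_gt0 := agg_weights_gt0 g2s a2_gt0.
have a4_gt0 := agg_weights_gt0 g3s a3_gt0.
have consE := consensusE a2_gt0 a3_gt0 a4_gt0.
have M1B1 := Kmat_laplacian_group_B hadj1 a; have P1M1 := group_avg_laplacian hadj1 ha; have P1B1 := group_avg_group_B g1s ha.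
have M2B2 := Kmat_laplacian_group_B hadj2 (a2 g1 a); have P2M2 := group_avg_laplacian hadj2 a2_gt0.
have P2B2 := group_avg_group_B g2s a2_gt0.
have M3B3 := Kmat_laplacian_group_B hadj3 (a3 g1 g2 a); have P3M3 := group_avg_laplacian hadj3 a3_gt0.
have P3B3 := group_avg_group_B g3s a3_gt0.
have C1B1 := group_CB hC1; have C2B2 := group_CB hC2.
have L1 := layer_sqint g1s hadj1 ha.
have L2 := layer_sqint g2s hadj2 a2_gt0.
have L3 := layer_sqint g3s hadj3 a3_gt0.
have to_delay := @hier_solution_delay R N1 N2 N3 g1 g2 adj1 adj2 adj3 a C1 C2
  tau2 tau3 htau2 htau3.
have of_delay := @delay_hier_solution R N1 N2 N3 g1 g2 adj1 adj2 adj3 a C1 C2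
  tau2 tau3 htau2 htau3.
rewrite /is_max_eigenvalue /Lmat2 /Lmat3 in hlam2 hlam3.
rewrite -(mulmxA (B1 R g1) (K2 g1 a)) in hlam2.
rewrite -(mulmxA _ (K3 g1 g2 a)) -(mulmxA _ C2 C1) in hlam3.
rewrite /B1 /B2 /K2 /K3 /LD2 /LD3 in hlam2 hlam3.
set P1 := group_avg g1 a in consE P1M1 P1B1 L1.
set P2 := group_avg g2 _ in consE P2M2 P2B2 L2.
set P3 := group_avg g3 _ in consE P3M3 P3B3 L3.
set M1 := Kmat a *m _ in M1B1 P1M1 L1 to_delay of_delay.
set M2 := Kmat (a2 g1 a) *m _ in M2B2 P2M2 L2 hlam2 to_delay of_delay.
set M3 := Kmat (a3 g1 g2 a) *m _ in M3B3 P3M3 L3 hlam3 to_delay of_delay.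
set B1 := group_B R g1 in consE M1B1 P1B1 C1B1 hlam2 hlam3 to_delay of_delay.
set B2 := group_B R g2 in consE M2B2 P2B2 C2B2 hlam3 to_delay of_delay.
set B3 := group_B R g3 in consE M3B3 P3B3.
have CC : (C2 *m C1) *m (B1 *m B2) = 1%:M.
  by rewrite !mulmxA -(mulmxA C2) C1B1 mulmx1.
have [lam2E lam2max] := hlam2; have [lam3E lam3max] := hlam3.
clearbody M1 M2 M3 B1 B2 B3 P1 P2 P3.
have pi0 := pi_gt0 R.
pose tau := 2 * tau2; pose sigma := 2 * (tau2 + tau3).
split=> [H|[H2 H3] x0 x1 x2 x3 y1 y2 /to_delay[x10 cx [s dx]]]; last first.
  (* The lowest layer acts without delay. For the others, [mu <= lam2] gives
     [mu * tau <= 2 * lam2 * tau2 < pi / 2], and similarly with [lam3] and [sigma]. *)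
  have st1 : stable_layer M1 P1 0.
    by move=> T z f; apply: L1 => // mu _ _; rewrite mulr0 divr_gt0.
  have st2 : stable_layer M2 P2 tau.
    move=> T z f; apply: L2; first by rewrite /tau; lra.
    move=> mu mu0 muE; have := lam2max _ (eigenvalue_conj C1B1 muE); rewrite /tau; nra.
  have st3 : stable_layer M3 P3 sigma.
    move=> T z f; apply: L3; first by rewrite /sigma; lra.
    move=> mu mu0 muE; have := lam3max _ (eigenvalue_conj CC muE); rewrite /sigma; nra.
  have [T T0 sT] := exists_above s.
  have tau_ge0 : 0 <= tau by rewrite /tau; lra.
  have sigma_ge0 : 0 <= sigma by rewrite /sigma; lra.
  have cvgP := hier_cvg tau_ge0 sigma_ge0 M1B1 M2B2 M3B3 P1M1 P2M2 P3M3 P1B1 P2B2 P3B3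
    C1B1 C2B2 st1 st2 st3.
  have dxT t : T < t -> is_derive t 1 x1 (hier_field M1 M2 M3 B1 B2 C1 C2 tau sigma x1 t).
    by move=> Tt; apply: dx; [exact: le_lt_trans Tt|exact: sT].
  rewrite -consE; apply: (cvgP _ _ _ dxT) => t Tt; have t0 := le_lt_trans T0 Tt.
  rewrite -x10; apply/matrixP => i j.
  (* The total average is continuous and has zero derivative off the switching times, so it keeps
     its initial value. *)
  pose f (t : R) : R := (P3 *m (P2 *m (P1 *m x1 (Num.max t 0)))) i j.
  have cf : continuous f.
    move=> u; have cu : x1 (Num.max v 0) @[v --> u] --> x1 (Num.max u 0).
      exact: within_ray_comp_max.
    have : P3 *m (P2 *m (P1 *m x1 (Num.max v 0))) @[v --> u] -->
           P3 *m (P2 *m (P1 *m x1 (Num.max u 0))).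
      by apply: cvg_mulmx; apply: cvg_mulmx; exact: cvg_mulmx.
    by move=> /cvg_mxP; exact.
  suff : f 0 = f t by rewrite /f maxxx (max_l (ltW t0)).
  apply: (@cst_off_finite _ f s 0 t (ltW t0) cf) => u /andP[u0 ut] us.
  apply: (@der_near _ (fun u => (P3 *m (P2 *m (P1 *m x1 u))) i j)).
    by near=> v; rewrite /f max_l// ltW//; near: v; exact: lt_nbhsr.
  have := der_mulmx P3 (der_mulmx P2 (der_mulmx P1 (dx u u0 us))).
  by rewrite avg_hier_field// => /der_mxP/(_ i j); rewrite mxE.
split; rewrite ltNge; apply/negP => bad.
  have tau2_gt0 : 0 < tau2.
    rewrite lt_neqAle htau2 andbT; apply/eqP => t0.
    by move: bad; rewrite -t0 mulr0; lra.
  have lam2_gt0 : 0 < lam2 by rewrite ltNge; apply/negP => l0; nra.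
  have [l lM l0] := eigenvector_conj C1B1 (lt0r_neq0 lam2_gt0) lam2E.
  have tau_gt0 : 0 < tau by rewrite /tau; lra.
  have sigma_gt0 : 0 < sigma by rewrite /sigma; lra.
  (* States of the form [B1 *m u] are invariant, since [M1] annihilates them and [C1] recovers [u].
     In [u] the term from layer 3 lies in the range of [B2], as [unstable_layer] requires. *)
  have [u [u_lt0 u0 cu du]] := delay_exists M2 (B2 *m (M3 *m C2)) l^T tau_gt0 sigma_gt0.
  have [||||x2 [x3 [y1 [y2 sol]]]] := of_delay (B1 *m l^T) (fun t => B1 *m u t) [:: tau; sigma].
  - by move=> t t0; rewrite u_lt0// mulmx0.
  - by rewrite u0.
  - exact: within_mulmx.
  - move=> t t0 ts; apply: (is_derive_eq (der_mulmx B1 (du t t0 ts))).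
    rewrite /hier_field !mulmxA M1B1 mul0mx oppr0 add0r -!(mulmxA _ C1 B1) C1B1 !mulmx1.
    by rewrite !(mulmxDr, mulmxN, mulmxA).
  have /H := sol; rewrite -consE => xcvg.
  have ucvg : u t @[t --> +oo] --> B2 *m (B3 *m (P3 *m (P2 *m (P1 *m (B1 *m l^T))))).
    rewrite -[X in _ --> X]mul1mx -C1B1 -mulmxA.
    rewrite (_ : u = fun t => C1 *m (B1 *m u t)).
      exact: cvg_mulmx.
    by apply/funext => t; rewrite mulmxA C1B1 mul1mx.
  apply: (unstable_layer (w := fun t => M3 *m C2 *m u (t - sigma)) M2B2 lM l0 lam2_gt0
    tau_gt0 _ u_lt0 u0 cu _ ucvg) => [|t t0 ts]; first by rewrite /tau; nra.
  by have := du t t0 ts; rewrite !mulmxA.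
have tau23_gt0 : 0 < tau2 + tau3.
  rewrite lt_neqAle addr_ge0// andbT; apply/eqP => t0.
  by move: bad; rewrite -t0 mulr0; lra.
have lam3_gt0 : 0 < lam3 by rewrite ltNge; apply/negP => l0; nra.
have [l lM l0] := eigenvector_conj CC (lt0r_neq0 lam3_gt0) lam3E.
have sigma_gt0 : 0 < sigma by rewrite /sigma; lra.
(* Starting in the range of [B1 *m B2] leaves only layer 3 active. Its one delay is passed twice
   with a zero second coefficient, as [tau] may be 0 here. *)
have [u [u_lt0 u0 cu du]] := delay_exists M3 0 l^T sigma_gt0 sigma_gt0.
have [||||x2 [x3 [y1 [y2 sol]]]] :=
  of_delay (B1 *m (B2 *m l^T)) (fun t => B1 *m (B2 *m u t)) [:: sigma; sigma].
- by move=> t t0; rewrite u_lt0// !mulmx0.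
- by rewrite u0.
- by apply: within_mulmx; exact: within_mulmx.
- move=> t t0 ts; apply: (is_derive_eq (der_mulmx B1 (der_mulmx B2 (du t t0 ts)))).
  rewrite /hier_field !mul0mx subr0 !mulmxA M1B1 !mul0mx oppr0 add0r.
  rewrite -!(mulmxA _ C1 B1) C1B1 !mulmx1 -(mulmxA _ M2 B2) M2B2 mulmx0 mul0mx oppr0 add0r.
  by rewrite -(mulmxA _ C2 B2) C2B2 mulmx1 !(mulmxN, mulmxA).
have /H := sol; rewrite -consE => xcvg.
have ucvg : u t @[t --> +oo] --> B3 *m (P3 *m (P2 *m (P1 *m (B1 *m (B2 *m l^T))))).
  rewrite -[X in _ --> X]mul1mx -CC -!mulmxA.
  rewrite (_ : u = fun t => C2 *m (C1 *m (B1 *m (B2 *m u t)))).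
    by apply: cvg_mulmx; exact: cvg_mulmx.
  by apply/funext => t; rewrite (mulmxA C1) C1B1 mul1mx mulmxA C2B2 mul1mx.
apply: (unstable_layer (w := fun=> 0) M3B3 lM l0 lam3_gt0
  sigma_gt0 _ u_lt0 u0 cu _ ucvg) => [|t t0 ts]; first by rewrite /sigma; nra.
by have := du t t0 ts; rewrite mul0mx mulmx0.
Unshelve. all: by end_near. Qed.
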